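(* Let $a<b$ be real numbers and let $P=f\cdot\lambda_1$ be a probability measure where $f:[a,b]\to\mathbb{R}_+$ is a Lipschitz continuous probability density function, bounded away from $0$ on $[a,b]$. Let $r>0$. Let $(\alpha_n)_{n\ge1}$ be a sequence of $L^r$-stationary and asymptotically $L^r$-optimal $[a,b]$-valued $n$-quantizers for $P$. Then for every $s>0$, $$\lim_{n\to\infty}\left(n^s\int_a^b\min_{c\in\alpha_n}|x-c|^s\,dP(x)\right)=Q_{r,s}(P).$$
   Context: $\lambda_1$ is Lebesgue measure on $\mathbb{R}$. For a probability measure $\mu$ on $\mathbb{R}$ with finite $r$-th moment, $e_{n,r}(\mu)=\inf\{(\int \min_{c\in\alpha}|x-c|^r\,d\mu(x))^{1/r}:\alpha\subset\mathbb{R},\ 1\le\mathrm{card}(\alpha)\le n\}$. A sequence $(\alpha_n)_{n\ge1}$ of finite nonempty subsets $\alpha_n\subset[a,b]$ is an asymptotically $L^r$-optimal sequence of ($[a,b]$-valued) $n$-quantizers for $P$ if $\mathrm{card}(\alpha_n)\le n$ for all $n$ and $\int\min_{c\in\alpha_n}|x-c|^r\,dP(x)\sim e_{n,r}(P)^r$ as $n\to\infty$ (ratio tends to $1$). A finite set $\alpha=\{c_1<\dots<c_m\}\subset[a,b]$ is $L^r$-stationary for $P$ if for every $k\in\{1,\dots,m\}$ $$\int_{V_k}|c_k-x|^{r-1}\,\mathrm{sign}(c_k-x)\,f(x)\,dx=0,$$ where $V_k$ is the Voronoi cell of $c_k$ in $[a,b]$, i.e. the interval of points of $[a,b]$ between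 $\frac{c_{k-1}+c_k}{2}$ and $\frac{c_k+c_{k+1}}{2}$ (with left endpoint $a$ for $k=1$ and right endpoint $b$ for $k=m$). Finally, with $J_{s,1}:=\inf_{n\ge1}n^s e_{n,s}(U([0,1]))^s$ ($U([0,1])$ the uniform distribution on $[0,1]$), $$Q_{r,s}(P):=J_{s,1}\left(\int_a^b f^{\frac1{r+1}}\,d\lambda_1\right)^{s}\int_a^b f^{1-\frac{s}{r+1}}\,d\lambda_1 .$$ *)

(* Defs.v *)
From HB Require Import structures.
From mathcomp Require Import all_boot all_order all_algebra finmap.
From mathcomp Require Import all_classical all_reals all_analysis.

Set Implicit Arguments.
Unset Strict Implicit.
Unset Printing Implicit Defensive.

Import Order.TTheory GRing.Theory Num.Theory.
Import numFieldNormedType.Exports.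

Local Open Scope classical_set_scope.
Local Open Scope ring_scope.

(* A quantizer is a {fset R}. Errors live in \bar R, so that infinite moments
   need no convention, and `x `^ t` on \bar R is poweR. *)

Section Quantization.
Variable R : realType.
Implicit Types (P : probability (measurableTypeR R) R) (f : R -> R)
  (a b r s x : R) (n k : nat) (A : {fset R}) (alpha : nat -> {fset R}).

(* f is only meaningful on [a, b]; that it integrates to 1 follows from P being
   a probability. *)
Definition has_density P a b f : Prop :=
  forall U : set (measurableTypeR R), measurable U ->
    P U = (\int[lebesgue_measure]_(x in U `&` `[a, b]) (f x)%:E)%E.

(* The unit +oo of mine is only visible when A is empty. *)
Definition min_dist r A x : \bar R :=
  (\big[mine/+oo]_(c <- A) (`|x - c| `^ r)%:E)%E.

Definition distortion P r A : \bar R := (\int[P]_x min_dist r A x)%E.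

(* e_{n,r}(P) *)
Definition quantization_error n r P : \bar R :=
  ereal_inf [set (distortion P r A `^ r^-1)%E
            | A in [set A | A != fset0 /\ (#|` A| <= n)%N]].

Definition quantizer a b n A : Prop :=
  [/\ A != fset0, [set` A] `<=` `[a, b] & (#|` A| <= n)%N].

(* Only the terms alpha n with n >= 1 are constrained. *)
Definition asymptotically_optimal P r a b alpha : Prop :=
  (forall n, (0 < n)%N -> quantizer a b n (alpha n)) /\
  (distortion P r (alpha n) / quantization_error n r P `^ r)%E
    @[n --> \oo] --> (1 : \bar R)%E.

(* The increasing enumeration c_1 < ... < c_m of A, indexed from 0. *)
Definition point A k : R := nth 0 (sort <=%R (enum_fset A)) k.

Definition voronoi_cell a b A k : set R :=
  [set x | (if k is k'.+1 then (point A k' + point A k) / 2 else a) <= x <=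
           (if k.+1 == #|` A| then b else (point A k + point A k.+1) / 2)].

(* For r < 1 the kernel is singular at x = c_k, where x `^ t is 0 at x = 0 and
   t != 0; this value is irrelevant to the integral. *)
Definition stationary a b f r A : Prop :=
  [set` A] `<=` `[a, b] /\
  forall k, (k < #|` A|)%N ->
    (\int[lebesgue_measure]_(x in voronoi_cell a b A k)
       (`|point A k - x| `^ (r - 1) * Num.sg (point A k - x) * f x)%:E = 0)%E.

(* J_{s,1} *)
Definition Jconst s : \bar R :=
  ereal_inf
    [set ((n%:R `^ s)%:E *
          quantization_error n s (uniform_prob (@ltr01 R)) `^ s)%E
    | n in [set n | (0 < n)%N]].

(* Q_{r,s}(P) for P with density f on [a, b] *)
Definition Qconst r s a b f : \bar R :=
  (Jconst s
   * (\int[lebesgue_measure]_(x in `[a, b]) (f x `^ (r + 1)^-1)%:E) `^ s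
   * \int[lebesgue_measure]_(x in `[a, b]) (f x `^ (1 - s / (r + 1)))%:E)%E.

End Quantization.

(* Main.v *)
Require Import Defs.
From HB Require Import structures.
From mathcomp Require Import all_boot all_order all_algebra finmap.
From mathcomp Require Import all_classical all_reals all_analysis.
From mathcomp Require Import measurable_realfun.
From mathcomp Require Import ring lra zify.

Import Order.TTheory GRing.Theory Num.Theory.
Import numFieldNormedType.Exports.
Local Open Scope classical_set_scope.
Local Open Scope ring_scope.

Set Implicit Arguments.
Unset Strict Implicit.
Unset Printing Implicit Defensive.

(** The half-cells of a quantizer are the pieces into which its points and the
midpoints between them cut [[a, b]]. On a half-cell of length [h] the distance to
the quantizer is the distance to one endpoint, so the distortion of exponent [s]
is close to the sum of [f h^(s+1) / (s+1)] over the half-cells, provided that the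
lengths tend to zero. The theorem thus asks for the limit of [n^s] times this sum,
for every [s], while optimality is about [s = r] only.

Stationarity at a point says that the integrals of [|x - c|^(r-1) f] over the two
adjacent half-cells agree. Since [ln f] is Lipschitz, the ratio of the two lengths
is at most [exp (K (h + h'))] ([stationary_half_cells]). Half-cells sharing a
midpoint have equal lengths. The exponents telescope along [[a, b]], so any two
half-cells have lengths within a constant factor that does not depend on [n]
([stationary_gaps]). Their number is at most [2 n], and the distortion of exponent
[r] is of order [n^-r] by optimality; hence all the numbers [n h] lie between two
positive constants ([gap_lower], [gap_upper]). This is what makes large exponents
[s] harmless.

Let [w = f^(1/(r+1))], let [I] be its integral, and let [y = 2 n h w / I] be the
length of a half-cell relative to the one, [I / (2 n w)], of a quantizer with point
density [w / I]. The function [y^r + r / y - (r + 1)] is nonnegative and vanishes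
at [y = 1] only ([excess]). Its sum over the half-cells, weighted by [h w], is a
combination of the distortion, of the number of half-cells and of [I]
([excess_sum]). The quantiles of [w] give a quantizer of distortion at most
[I^(r+1) / ((2 n)^r (r+1))] up to a factor tending to one
([quantization_error_upper]), so for an asymptotically optimal sequence the
weighted sum tends to zero. As the [y] stay in a compact subset of the positive
half-line, where [|y^s - 1|] is at most [e] plus a multiple of the excess
([powR_sub1_le_excess]), every [y^s] may be replaced by 1 in the limit
([mismatch_bounds]). What remains is a Riemann sum of [f^(1 - s/(r+1))] times
[(I / 2)^s / (s + 1)].

Finally [1 / (2^s (s+1))] is the constant of the uniform distribution: among
errors of exponent [s], a point improves on the constant error [H^s] by an amount
whose integral is bounded independently of its position, and [H = 1 / (2 n)] gives
the sharp bound ([JconstE]). *)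

(** * Integrals of powers of the distance to a point *)

Lemma itv_oo_bigcup_cc (R : realType) (u v : R) : u < v ->
  `]u, v[%classic =
  \bigcup_k `[u + (v - u) / k.+3%:R, v - (v - u) / k.+3%:R]%classic.
Proof.
move=> uv; have d0 : 0 < v - u by rewrite subr_gt0.
apply/seteqP; split => x /=; rewrite in_itv/=.
  move=> /andP[ux xv].
  have m0 : 0 < Num.min (x - u) (v - x) by rewrite lt_min !subr_gt0 ux.
  have [k kP] : exists k : nat, (v - u) / Num.min (x - u) (v - x) <= k%:R.
    exists (Num.bound ((v - u) / Num.min (x - u) (v - x))).
    apply/ltW/archi_boundP; rewrite divr_ge0 // ltW //.
  exists k => //=; rewrite in_itv/=.
  have : (v - u) / k.+3%:R <= Num.min (x - u) (v - x).
    rewrite ler_pdivrMr // mulrC -ler_pdivrMr //.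
    by apply: (le_trans kP); rewrite ler_nat; lia.
  rewrite le_min; set e := _ / _ => /andP[H1 H2] {m0 kP}.
  by apply/andP; split; lra.
move=> [k _] /=; rewrite in_itv/= => /andP[].
have : 0 < (v - u) / k.+3%:R by rewrite divr_gt0.
set e := _ / _.
by move=> *; apply/andP; split; lra.
Qed.

(** Exhausting the open interval from inside, by monotone convergence, lets the
integrand be unbounded at both endpoints: the kernels [`|x - c| `^ (t - 1)] with
[t < 1] require this. *)
Lemma ge0_improper_FTC2 (R : realType) (g F : R -> R) (u v : R) : u < v ->
  (forall x, x \in `]u, v[ -> 0 <= g x) ->
  {in `]u, v[, continuous g} ->
  {within `[u, v], continuous F} ->
  (forall x : R, x \in `]u, v[ -> is_derive x (1 : R) F (g x)) ->
  (\int[lebesgue_measure]_(x in `[u, v]) (g x)%:E = (F v - F u)%:E)%E.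
Proof.
move=> uv g0 cg cF dF; have d0 : 0 < v - u by rewrite subr_gt0.
have mg : measurable_fun `]u, v[ g.
  by apply: open_continuous_measurable_fun => // x; rewrite inE; exact: cg.
rewrite integral_itv_bndoo; last exact/measurable_EFinP.
rewrite itv_oo_bigcup_cc //.
pose e k : R := (v - u) / k.+3%:R.
have e0 k : 0 < e k by rewrite divr_gt0.
have e3 k : e k <= (v - u) / 3.
  by rewrite ler_pM2l // lef_pV2 ?posrE // ler_nat.
have sub k : `[u + e k, v - e k] `<=` `]u, v[.
  by move=> x /=; rewrite !in_itv/= => /andP[? ?]; have := e0 k; lra.
pose I k : set R := `[u + e k, v - e k]%classic.
have nd : nondecreasing_seq I.
  move=> i j ij; apply/subsetPset => x; rewrite /I /= !in_itv/=.
  have : e j <= e i by rewrite ler_pM2l // lef_pV2 ?posrE // ler_nat ltnS.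
  by move=> ? /andP[? ?]; apply/andP; split; lra.
have /cvg_lim <- // : (\int[lebesgue_measure]_(x in I k) (g x)%:E
    @[k --> \oo] --> \int[lebesgue_measure]_(x in
      \bigcup_k I k) (g x)%:E)%E.
  apply: ge0_nondecreasing_set_cvg_integral => //.
  - by move=> k; exact: measurable_itv.
  - by move=> k; apply/measurable_EFinP; apply: measurable_funS mg => //; exact: sub.
  - by move=> k x /sub xuv; rewrite lee_fin g0.
have [cFi cFu cFv] := (continuous_within_itvP _ uv).1 cF.
apply/cvg_lim => //.
have e_cvg : e k @[k --> \oo] --> (0 : R).
  rewrite -(mulr0 (v - u)); apply: cvgMl_tmp.
  have := @cvg_harmonic R; rewrite -(cvg_shiftn 2) /=.
  by apply: cvg_trans; apply: near_eq_cvg; apply: nearW => k /=; rewrite addn2.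
suff -> : (fun k => (\int[lebesgue_measure]_(x in I k)
    (g x)%:E)%E) = (fun k => (F (v - e k) - F (u + e k))%:E).
  apply: cvg_EFin; first exact: nearW.
  suff : F (v - e k) - F (u + e k) @[k --> \oo] --> F v - F u by [].
  apply: cvgB; [apply: (cvg_comp _ F _ cFv)|apply: (cvg_comp _ F _ cFu)].
    move=> A [d /= dp dA]; apply: filterS (cvgr_lt _ e_cvg _ dp) => k ek.
    apply: dA => /=; last by have := e0 k; lra.
    by rewrite opprB addrCA subrr addr0 gtr0_norm.
  move=> A [d /= dp dA]; apply: filterS (cvgr_lt _ e_cvg _ dp) => k ek.
  apply: dA => /=; last by have := e0 k; lra.
  by rewrite opprD addNKr normrN gtr0_norm.
apply/funext => k.
rewrite /I; have uvk : u + e k < v - e k by have := e3 k; lra.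
have sub2 x : x \in `]u + e k, v - e k[ -> x \in `]u, v[.
  by rewrite !in_itv/= => /andP[? ?]; have := e0 k; lra.
rewrite (@continuous_FTC2 _ g F) //.
- apply/continuous_within_itvP => //; split.
  + by move=> x /sub2; exact: cg.
  + apply/cvg_at_right_filter/cg; rewrite in_itv/=; have := e0 k; have := e3 k; lra.
  + apply/cvg_at_left_filter/cg; rewrite in_itv/=; have := e0 k; have := e3 k; lra.
- split.
  + by move=> x /sub2 /dF [].
  + apply/cvg_at_right_filter/cFi; rewrite in_itv/=; have := e0 k; have := e3 k; lra.
  + apply/cvg_at_left_filter/cFi; rewrite in_itv/=; have := e0 k; have := e3 k; lra.
- by move=> x /sub2 /dF [_ <-]; rewrite derive1E.
Qed.

Lemma measurable_dist_powR (R : realType) (D : set R) (c p : R) :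
  measurable_fun D (fun x : R => `|x - c| `^ p).
Proof.
apply: (measurableT_comp (measurable_powR p)).
by apply: measurableT_comp => //; apply: measurable_funB.
Qed.

Lemma continuous_dist_powR (R : realType) (c t : R) : 0 < t ->
  continuous (fun x : R => `|x - c| `^ t).
Proof.
move=> t0 x.
have cd (y : R) : {for y, continuous (fun y : R => `|y - c|)}.
  by apply: continuous_comp;
    [apply: cvgB; [exact: cvg_id|exact: cvg_cst]|exact: norm_continuous].
have [->|xc] := eqVneq x c.
  rewrite /continuous_at /= subrr normr0 powR0 ?gt_eqF //.
  apply/cvgr0Pnorm_lt => e e0.
  have d0 : 0 < e `^ t^-1 by rewrite powR_gt0.
  have := cd c; rewrite /prop_for /continuous_at /= subrr normr0.
  move=> /(cvgr_lt _)/(_ _ d0); apply: filterS => y yd.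
  rewrite ger0_norm ?powR_ge0 // -[ltRHS]powRr1 ?ltW // -(mulVf (lt0r_neq0 t0)).
  by rewrite powRrM gt0_ltr_powR ?nnegrE ?powR_ge0.
apply: (continuous_comp (f := fun y : R => `|y - c|) (g := @powR R ^~ t)) => //.
apply: differentiable_continuous; apply/derivable1_diffP.
by apply: derivable_powR; rewrite in_itv/= andbT normr_gt0 subr_eq0.
Qed.

Lemma is_derive_dist_powR (R : realType) (c t x : R) : x != c ->
  is_derive x (1 : R) (fun y : R => `|y - c| `^ t)
    (t * `|x - c| `^ (t - 1) * Num.sg (x - c)).
Proof.
move=> xc; have xc0 : x - c != 0 by rewrite subr_eq0.
pose e := Num.sg (x - c).
have D0 : is_derive x (1:R) (fun y : R => e * (y - c)) e.
  apply: is_derive_eq; rewrite /GRing.scale /= subr0; exact: mulr1.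
have ex : e * (x - c) = `|x - c| by rewrite [RHS]normrEsg.
have D1 : is_derive (e * (x - c)) (1 : R) (@powR R ^~ t)
    (t * `|x - c| `^ (t - 1)).
  by rewrite ex; apply: is_derive1_powR; rewrite normr_gt0.
have := @is_derive1_comp _ (@powR R ^~ t) (fun y => e * (y - c)) x _ _ D1 D0; apply: near_eq_is_derive.
have cd : {for x, continuous (fun y : R => e * (y - c))}.
  by apply: cvgM; [exact: cvg_cst|apply: cvgB; [exact: cvg_id|exact: cvg_cst]].
have e0 : 0 < e * (x - c) by rewrite ex normr_gt0.
move: cd => /(cvgr_gt _)/(_ _ e0); apply: filterS => y y0 /=.
by rewrite -(gtr0_norm y0) normrM /e normr_sg xc0 mul1r.
Qed.

Lemma integral_dist_powR (R : realType) (t u v c : R) : 0 < t -> u <= v ->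
  c = u \/ c = v ->
  (\int[lebesgue_measure]_(x in `[u, v]) (`|x - c| `^ (t - 1))%:E =
   ((v - u) `^ t / t)%:E)%E.
Proof.
move=> t0; rewrite le_eqVlt => /predU1P[->|uv] cuv.
  by rewrite set_itv1 integral_set1 subrr powR0 ?gt_eqF // mul0r.
pose e : R := if c == u then 1 else -1.
have sgc x : x \in `]u, v[ -> Num.sg (x - c) = e.
  rewrite in_itv/= /e => /andP[ux xv]; case: cuv => ->; rewrite ?eqxx.
    by rewrite gtr0_sg // subr_gt0.
  by rewrite (gt_eqF uv) ltr0_sg // subr_lt0.
have e2 : e * e = 1 by rewrite /e; case: ifP; rewrite ?mulr1 // mulrNN mulr1.
have xNc x : x \in `]u, v[ -> x != c.
  move=> /sgc; apply: contra_eq_neq => ->; rewrite subrr sgr0 eq_sym.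
  by apply/eqP => e0; move: e2; rewrite e0 mul0r => /esym/eqP; rewrite oner_eq0.
pose F (y : R) := e / t * `|y - c| `^ t.
transitivity ((F v - F u)%:E).
  apply: (@ge0_improper_FTC2 _ (fun x => `|x - c| `^ (t - 1)) F) => //.
  - move=> x /xNc xc.
    apply: differentiable_continuous; apply/derivable1_diffP.
    by have [] := @is_derive_dist_powR _ c (t - 1) x xc.
  - apply: continuous_subspaceT => x; apply: cvgM; first exact: cvg_cst.
    exact: continuous_dist_powR.
  - move=> x xuv.
    have := @is_derive_dist_powR _ c t x (xNc x xuv); rewrite (sgc x xuv) => ?.
    apply: is_derive_eq; rewrite /GRing.scale /=.
    by rewrite [_ * e]mulrC 2!mulrA -[e / t * e]mulrAC e2 mul1r mulVf ?mul1r ?gt_eqF.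
rewrite /F /e; case: cuv => ->; rewrite ?eqxx ?(gt_eqF uv) subrr normr0 powR0 ?gt_eqF //.
  by rewrite gtr0_norm ?subr_gt0 // mulr0 subr0 mulrC mulrA mulr1.
by rewrite ltr0_norm ?subr_lt0 // opprB mulr0 sub0r !mulNr opprK mul1r mulrC.
Qed.

(** * Log-Lipschitz functions *)

(** Lipschitz continuity of the logarithm, with the positivity and measurability
that go with it. Unlike Lipschitz continuity it is stable under real powers, and
it turns errors into factors that multiply. *)
Definition log_lipschitz (R : realType) (k a b : R) (g : R -> R) : Prop :=
  [/\ measurable_fun `[a, b] g,
      {in `[a, b], forall x, 0 < g x} &
      {in `[a, b] &, forall x y, g x <= g y * expR (k * `|x - y|)}].

(** The lower bound turns an absolute error into a relative one, and
[1 + t <= exp t] makes it a factor. *)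
Lemma lipschitz_log_lipschitz (R : realType) (a b m : R) (f : R -> R) :
  [lipschitz f x | x in `[a, b]] -> 0 < m ->
  (forall x, x \in `[a, b] -> m <= f x) ->
  exists2 k, 0 <= k & log_lipschitz k a b f.
Proof.
move=> lipf m0 mf.
have [L L0 Lf] : exists2 L : R, 0 < L &
    {in `[a, b] &, forall x y, `|f x - f y| <= L * `|x - y|}.
  near (pinfty_nbhs R) => L.
  have lL : L.-lipschitz_(`[a, b]) f by near: L.
  exists L; first by near: L; exact: nbhs_pinfty_gt.
  by move=> x y xab yab; exact: (lL (x, y)).
exists (L / m); first by rewrite divr_ge0 ?ltW.
split.
- apply: subspace_continuous_measurable_fun => //.
  apply/subspace_continuousP => x xab.
  apply/cvgrPdist_lt => e e0 /=.
  have d0 : 0 < e / L by rewrite divr_gt0.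
  near=> y.
  apply: (le_lt_trans (Lf _ _ _ _)) => //; first by near: y; exact: withinT.
  rewrite mulrC -ltr_pdivlMr //; near: y; apply: cvg_within.
  by exists (e / L).
- by move=> x xab; apply: (lt_le_trans m0); exact: mf.
move=> x y xab yab.
have fy0 : 0 < f y by apply: (lt_le_trans m0); exact: mf.
apply: le_trans (_ : f y * (1 + L / m * `|x - y|) <= _); last first.
  by rewrite ler_pM2l // expR_ge1Dx.
rewrite mulrDr mulr1 -lerBlDl (le_trans (ler_norm _)) // (le_trans (Lf _ _ _ _)) //.
rewrite [leRHS]mulrA ler_wpM2r // mulrCA.
by apply: ler_peMr; rewrite ?(ltW L0) // ler_pdivlMr // mul1r; exact: mf.
Unshelve. all: by end_near.
Qed.

Section log_lipschitz.
Context {R : realType}.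
Implicit Types (k a b u v c p : R) (g w : R -> R).
Local Notation mu := (@lebesgue_measure R).

Lemma log_lipschitzS k a b u v g : a <= u -> v <= b ->
  log_lipschitz k a b g -> log_lipschitz k u v g.
Proof.
move=> au vb [mg g0 gk].
have sub x : x \in `[u, v] -> x \in `[a, b].
  by rewrite !in_itv/= => /andP[ux xv]; rewrite (le_trans au) ?(le_trans xv).
split=> [|x /sub|x y /sub xab /sub yab]; [|exact: g0|exact: gk].
by apply: measurable_funS mg => // x /sub.
Qed.

Lemma log_lipschitz_powR k a b p g :
  log_lipschitz k a b g -> log_lipschitz (k * `|p|) a b (fun x => g x `^ p).
Proof.
move=> [mg g0 gk]; split.
- exact: (measurableT_comp (measurable_powR p)).
- by move=> x /g0 gx; exact: powR_gt0.
move=> x y xab yab.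
have [gx gy] := (g0 _ xab, g0 _ yab).
have powk q z t : z \in `[a, b] -> t \in `[a, b] -> 0 <= q ->
    g z `^ q <= g t `^ q * expR (k * `|z - t| * q).
  move=> zab tab q0; have [gz gt] := (g0 _ zab, g0 _ tab).
  rewrite expRM -powRM ?expR_ge0 ?(ltW gt) //.
  by apply: ge0_ler_powR; rewrite ?nnegrE ?mulr_ge0 ?expR_ge0 ?(ltW gt) ?(ltW gz) ?gk.
rewrite mulrAC; have [p0|p0] := leP 0 p; first by rewrite (ger0_norm p0) powk.
rewrite (ltr0_norm p0) -[p in X in X <= _]opprK -[p in X in _ <= X * _]opprK.
rewrite !(powRN _ (- p)) mulrC ler_pdivlMr ?powR_gt0 // mulrC ler_pdivrMr ?powR_gt0 //.
by rewrite mulrC distrC powk // oppr_ge0 ltW.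
Qed.

(** Freezing [g] at a point costs a factor [exp (k * (v - u))] whatever the kernel
[w], so the singular kernels of stationarity and the powers of the distortion are
treated alike. *)
Lemma log_lipschitz_integral k u v c g w I : 0 <= k ->
  log_lipschitz k u v g -> c \in `[u, v] ->
  measurable_fun `[u, v] w -> {in `[u, v], forall x, 0 <= w x} ->
  (\int[mu]_(x in `[u, v]) (w x)%:E = I%:E)%E ->
  ((g c * expR (- (k * (v - u))) * I)%:E
     <= \int[mu]_(x in `[u, v]) (w x * g x)%:E
     <= (g c * expR (k * (v - u)) * I)%:E)%E.
Proof.
move=> k0 [mg g0 gk] cuv mw w0 wI.
have gc := g0 _ cuv.
have dc x : x \in `[u, v] -> `|x - c| <= v - u.
  move: cuv; rewrite !in_itv/= => /andP[uc cv] /andP[ux xv].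
  by rewrite ler_norml; apply/andP; split; lra.
have mwg : measurable_fun `[u, v] (fun x => (w x * g x)%:E).
  by apply/measurable_EFinP; exact: measurable_funM.
rewrite !(EFinM _ I) -wI; apply/andP; split; rewrite -ge0_integralZl_EFin //=.
- apply: ge0_le_integral => //=.
  + by move=> x /w0 wx; rewrite mule_ge0 // lee_fin // mulr_ge0 ?expR_ge0 ?(ltW gc).
  + by apply: emeasurable_funM => //; exact/measurable_EFinP.
  + move=> x xuv; rewrite -EFinM lee_fin mulrC ler_wpM2l ?w0 //.
    rewrite expRN ler_pdivrMr ?expR_gt0 // (le_trans (gk _ _ cuv xuv)) //.
    by rewrite ler_wpM2l ?(ltW (g0 _ xuv)) // ler_expR ler_wpM2l // distrC dc.
- exact/measurable_EFinP.
- by rewrite mulr_ge0 ?expR_ge0 ?(ltW gc).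
- apply: ge0_le_integral => //=.
  + by move=> x xuv; rewrite lee_fin mulr_ge0 ?w0 // ltW ?g0.
  + by apply: emeasurable_funM => //; exact/measurable_EFinP.
  + move=> x xuv; rewrite -EFinM lee_fin mulrC ler_wpM2r ?w0 //.
    rewrite (le_trans (gk _ _ xuv cuv)) //.
    by rewrite ler_wpM2l ?(ltW gc) // ler_expR ler_wpM2l // dc.
- exact/measurable_EFinP.
- by rewrite mulr_ge0 ?expR_ge0 ?(ltW gc).
Qed.

Lemma log_lipschitz_integral1 k u v c g : 0 <= k ->
  log_lipschitz k u v g -> c \in `[u, v] ->
  ((g c * expR (- (k * (v - u))) * (v - u))%:E
     <= \int[mu]_(x in `[u, v]) (g x)%:E
     <= (g c * expR (k * (v - u)) * (v - u))%:E)%E.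
Proof.
move=> k0 guv cuv.
have uv : u <= v by move: cuv; rewrite in_itv/= => /andP[]; exact: le_trans.
have int1 : (\int[mu]_(x in `[u, v]) (cst 1 x)%:E = (v - u)%:E)%E.
  rewrite -[LHS]/(integral mu `[u, v]%classic (cst 1%:E)) integral_cst //= mul1e.
  rewrite lebesgue_measure_itv /= lte_fin; move: uv.
  by rewrite le_eqVlt => /predU1P[->|->] //; rewrite ltxx subrr.
have := log_lipschitz_integral k0 guv cuv (measurable_cst _)
  (fun _ _ => ler01) int1.
suff -> : (fun x => (cst 1 x * g x)%:E) = (fun x => (g x)%:E) by [].
by apply/funext => x; rewrite mul1r.
Qed.

End log_lipschitz.

(** * Integration against a density and over consecutive cells *)

(** The density is identified with the Radon-Nikodym derivative, for which the
change of variables is available. *)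
Lemma integral_has_density (R : realType) (a b : R) (f : R -> R)
    (P : probability (measurableTypeR R) R) (g : R -> \bar R) (E : set R) :
  has_density P a b f -> measurable_fun `[a, b] f ->
  (forall x, x \in `[a, b] -> 0 <= f x) ->
  measurable E -> measurable_fun setT g -> (forall x, 0 <= g x)%E ->
  (\int[P]_(x in E) g x =
   \int[lebesgue_measure]_(x in E `&` `[a, b]) (g x * (f x)%:E))%E.
Proof.
move=> hP mf f0 mE mg g0; set mu := lebesgue_measure.
pose F := f \_ `[a, b].
have F0 x : 0 <= F x by rewrite /F patchE; case: ifPn => // /set_mem/f0.
have mF : measurable_fun setT F by apply: (measurable_restrictT f _).1.
have PF U : measurable U -> (\int[mu]_(x in U) (F x)%:E = P U)%E.
  move=> mU; rewrite hP // integral_mkcondr; apply: eq_integral => x _.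
  by rewrite /F !patchE; case: ifP.
have Pmu : P `<< mu.
  apply/null_content_dominatesP => A mA A0; rewrite -PF // null_set_integral //.
  by apply/measurable_EFinP; exact: measurable_funTS.
rewrite -(@Radon_Nikodym_SigmaFinite.change_of_variables _ _ _ P mu Pmu) //;
  last exact: measurable_funTS.
have mRN := measurable_int _ (Radon_Nikodym_SigmaFinite.f_integrable Pmu).
rewrite integral_mkcondr (_ : integral _ _ (restrict _ _) =
    \int[mu]_(x in E) (g x * (F x)%:E))%E; last first.
  apply: eq_integral => x _; rewrite /F !patchE; case: ifP => //.
  by rewrite mule0.
have mgE := measurable_funTS mg : measurable_fun E g.
apply: ae_eq_integral => //.
- by apply: emeasurable_funM => //; exact: measurable_funTS.
- by apply: emeasurable_funM => //; apply/measurable_EFinP; exact: measurable_funTS.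
apply: ae_eqe_mul2l; apply: integral_ae_eq => //.
- by apply: integrableS (Radon_Nikodym_SigmaFinite.f_integrable Pmu).
- by apply/measurable_EFinP; exact: measurable_funTS.
- by move=> A _ mA; rewrite PF // -Radon_Nikodym_SigmaFinite.f_integral.
Qed.

(** Closed cells overlap only at their endpoints, which are null. *)
Lemma integral_itv_split (R : realType) (u v w : R) (g : R -> \bar R) :
  u <= v -> v <= w -> measurable_fun `[u, w] g ->
  (\int[lebesgue_measure]_(x in `[u, w]) g x =
   \int[lebesgue_measure]_(x in `[u, v]) g x +
   \int[lebesgue_measure]_(x in `[v, w]) g x)%E.
Proof.
move=> uv vw mg.
have -> : `[u, w]%classic = `[u, v[%classic `|` `[v, w]%classic.
  by rewrite -itv_bndbnd_setU ?bnd_simp.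
have mu1 : measurable_fun `[u, v[ g.
  apply: measurable_funS mg => // x /=; rewrite !in_itv/= => /andP[-> /ltW xv].
  exact: le_trans xv vw.
rewrite integral_setU //= ?integral_itv_bndo_bndc //.
- apply: measurable_funS mg => // x /= []; rewrite !in_itv/= => /andP[h1 h2].
    by rewrite h1 (le_trans (ltW h2)).
  by rewrite h2 (le_trans uv).
- rewrite disj_set2E; apply/eqP/seteqP; split => // x /= [].
  by rewrite !in_itv/= => /andP[_ xv] /andP[vx _]; move: (lt_le_trans xv vx); rewrite ltxx.
Qed.

Lemma integral_itv_cells (R : realType) (p : nat -> R) (N : nat)
    (g : R -> \bar R) : (forall j, (j < N)%N -> p j <= p j.+1) ->
  measurable_fun `[p 0%N, p N] g ->
  (\int[lebesgue_measure]_(x in `[p 0%N, p N]) g x =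
   \sum_(j < N) \int[lebesgue_measure]_(x in `[p j, p j.+1]) g x)%E.
Proof.
elim: N => [|N IHN] pS mg.
  by rewrite set_itv1 integral_set1 big_ord0.
have p0N : p 0%N <= p N.
  elim: N {IHN mg} pS => // N IHN pS.
  by apply: le_trans (pS N _) => //; apply: IHN => j jN; apply: pS; lia.
rewrite big_ord_recr /= -IHN; last 2 first.
- by move=> j jN; apply: pS; lia.
- apply: measurable_funS mg => // x /=; rewrite !in_itv/= => /andP[-> xN].
  by rewrite (le_trans xN) // pS.
by apply: integral_itv_split => //; exact: pS.
Qed.

(** * Points, boundaries and half-cells of a quantizer *)

(* The generic name is shadowed by the base point of pointed types. *)
Local Notation point := Defs.point.

Section points.
Context {R : realType}.
Implicit Types (A : {fset R}) (a b s x : R).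

Lemma size_sort_fset A : size (sort <=%R (enum_fset A)) = #|` A|.
Proof. by rewrite size_sort. Qed.

Lemma point_in A k : (k < #|` A|)%N -> point A k \in A.
Proof.
move=> kA; have : point A k \in sort <=%R (enum_fset A).
  by rewrite mem_nth // size_sort_fset.
by rewrite mem_sort.
Qed.

Lemma pointP A x : x \in A -> exists2 k, (k < #|` A|)%N & x = point A k.
Proof.
move=> xA; have : x \in sort <=%R (enum_fset A) by rewrite mem_sort.
by move=> /(nthP 0)[k]; rewrite size_sort_fset => kA <-; exists k.
Qed.

Lemma le_point A i j : (i <= j)%N -> (j < #|` A|)%N -> point A i <= point A j.
Proof.
move=> ij jA; apply: (sorted_leq_nth le_trans lexx) => //.
- exact: (sort_sorted (@le_total _ R)).
- by rewrite inE size_sort_fset (leq_ltn_trans ij).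
- by rewrite inE size_sort_fset.
Qed.

Lemma min_dist_le s A c x : c \in A -> (min_dist s A x <= (`|x - c| `^ s)%:E)%E.
Proof. by move=> cA; apply: (bigmin_inf_seq _ c). Qed.

Lemma le_min_dist s A x (y : \bar R) :
  (forall c, c \in A -> (y <= (`|x - c| `^ s)%:E)%E) -> (y <= min_dist s A x)%E.
Proof.
move=> yA; rewrite /min_dist big_seq; elim/big_rec: _ => [|c z cA yz].
  exact: leey.
by rewrite le_min yz andbT yA.
Qed.

(** Endpoints of the half-cells: the points sit at the odd indices, the cell
boundaries at the even ones, so that every half-cell has its point at one of its
two ends. *)
Definition node a b A j : R :=
  if odd j then point A j./2 else
  if j == 0%N then a else
  if j./2 == #|` A| then b else (point A j./2.-1 + point A j./2) / 2.

Lemma node_odd a b A k : node a b A k.*2.+1 = point A k.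
Proof. by rewrite /node /= odd_double /= uphalf_double. Qed.

Lemma node0 a b A : node a b A 0 = a. Proof. by []. Qed.

Lemma node_last a b A : A != fset0 -> node a b A #|` A|.*2 = b.
Proof.
rewrite -cardfs_gt0 /node odd_double doubleK eqxx double_eq0.
by move=> /lt0n_neq0/negPf ->.
Qed.

Lemma voronoi_cellE a b A k : (k < #|` A|)%N ->
  voronoi_cell a b A k = `[node a b A k.*2, node a b A k.*2.+2]%classic.
Proof.
move=> kA; apply/seteqP; suff E x :
  voronoi_cell a b A k x = (x \in `[node a b A k.*2, node a b A k.*2.+2]) by
  split=> x; rewrite /= E.
rewrite /voronoi_cell /= in_itv /= -doubleS; congr (is_true ((_ <= x) && (x <= _))).
  case: k kA => [|k] kA; first by rewrite node0.
  by rewrite /node odd_double double_eq0 /= doubleK (ltn_eqF kA).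
by rewrite /node odd_double double_eq0 /= doubleK.
Qed.

Section quantizer.
Variables (a b : R) (A : {fset R}).
Hypothesis Aab : [set` A] `<=` `[a, b].

Let Aitv k : (k < #|` A|)%N -> a <= point A k <= b.
Proof. by move=> /point_in /Aab /=; rewrite in_itv. Qed.

Lemma node_le j : (j < #|` A|.*2)%N -> node a b A j <= node a b A j.+1.
Proof.
rewrite -(odd_double_half j); case: (odd j); move: j./2 => k /= jA.
  have kA : (k < #|` A|)%N by rewrite -ltn_double; exact: ltnW jA.
  rewrite add1n node_odd -doubleS /node odd_double double_eq0 /= doubleK.
  case: eqVneq => [_|kA']; first by have /andP[] := Aitv kA.
  have kk : (k.+1 < #|` A|)%N by rewrite ltn_neqAle kA andbT.
  by have := le_point (leqnSn k) kk; rewrite /=; lra.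
have kA : (k < #|` A|)%N by rewrite -ltn_double.
rewrite add0n node_odd /node odd_double double_eq0 /= doubleK (ltn_eqF kA).
case: eqP => [_|k0]; first by have /andP[] := Aitv kA.
by have := le_point (leq_pred k) kA; lra.
Qed.

Lemma min_distE k s x : 0 < s -> (k < #|` A|)%N ->
  x \in `[node a b A k.*2, node a b A k.*2.+2] ->
  min_dist s A x = (`|x - point A k| `^ s)%:E.
Proof.
move=> s0 kA; rewrite in_itv /= => /andP[lx xr].
have kmin c : c \in A -> `|x - point A k| <= `|x - c|.
  move=> /pointP[i iA ->].
  have [ik|ki|->//] := ltngtP i k.
    have Ei : point A i <= point A k.-1 by apply: le_point; lia.
    have Ek : point A k.-1 <= point A k by apply: le_point; lia.
    have : (point A k.-1 + point A k) / 2 <= x.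
      move: lx; rewrite /node odd_double double_eq0 /= doubleK (ltn_eqF kA).
      by rewrite gtn_eqF //; lia.
    by move=> H; rewrite [leRHS]ger0_norm ?ler_norml; [apply/andP; split|]; lra.
  have Ei : point A k.+1 <= point A i by apply: le_point.
  have Ek : point A k <= point A k.+1 by apply: le_point => //; lia.
  have : x <= (point A k + point A k.+1) / 2.
    move: xr; rewrite -doubleS /node odd_double double_eq0 /= doubleK.
    by rewrite ltn_eqF //; exact: leq_ltn_trans ki iA.
  by move=> H; rewrite [leRHS]ler0_norm ?ler_norml; [apply/andP; split|]; lra.
apply/eqP; rewrite eq_le min_dist_le ?point_in //=.
apply: le_min_dist => c cA; rewrite lee_fin.
by apply: ge0_ler_powR; rewrite ?nnegrE ?kmin // ltW.
Qed.

End quantizer.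
End points.

(** * Stationarity as a balance between two half-cells *)

Lemma measurable_sgr (R : realType) (D : set R) :
  measurable_fun D (Num.sg : R -> R).
Proof.
have -> : (Num.sg : R -> R) = (fun x => \1_(`]0, +oo[) x - \1_(`]-oo, 0[) x).
  apply/funext => x; rewrite !indicE !mem_setE !in_itv/= andbT.
  have [x0|x0|x0] := ltgtP 0 x; last by rewrite -x0 sgr0 subrr.
    by rewrite gtr0_sg // subr0.
  by rewrite ltr0_sg // sub0r.
by apply: measurable_funB; apply: measurable_indic.
Qed.

(** On each side of [c] the integral of the kernel is [length `^ r / r], up to
freezing [f] at [c]; equating both sides and taking [r]-th roots bounds the ratio
of the two lengths. The bound is the exponential of a multiple of the length of
the cell, hence can be multiplied over consecutive cells. *)
Lemma stationary_half_cells (R : realType) (k a b r u c v : R) (f : R -> R) :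
  0 <= k -> log_lipschitz k a b f -> 0 < r -> a <= u -> u <= c -> c <= v -> v <= b ->
  (\int[lebesgue_measure]_(x in `[u, v])
     (`|c - x| `^ (r - 1) * Num.sg (c - x) * f x)%:E = 0)%E ->
  c - u <= expR (k / r * (v - u)) * (v - c) /\
  v - c <= expR (k / r * (v - u)) * (c - u).
Proof.
move=> k0 fab r0 au uc cv vb stat.
have fuc : log_lipschitz k u c f by apply: log_lipschitzS fab => //; exact: le_trans vb.
have fcv : log_lipschitz k c v f by apply: log_lipschitzS fab => //; exact: le_trans uc.
have [muv fuv _] : log_lipschitz k u v f by exact: log_lipschitzS fab.
pose w x := `|x - c| `^ (r - 1).
have mw D : measurable_fun D w by exact: measurable_dist_powR.
have cuc : c \in `[u, c] by rewrite in_itv/= uc lexx.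
have ccv : c \in `[c, v] by rewrite in_itv/= cv lexx.
have f0 : 0 < f c by apply: fuv; rewrite in_itv/= uc.
have wL := integral_dist_powR r0 uc (or_intror (erefl c)).
have wR := integral_dist_powR r0 cv (or_introl (erefl c)).
have w0 x : 0 <= w x by exact: powR_ge0.
have := log_lipschitz_integral k0 fuc cuc (mw _) (fun x _ => w0 x) wL.
have := log_lipschitz_integral k0 fcv ccv (mw _) (fun x _ => w0 x) wR.
pose L := (\int[lebesgue_measure]_(x in `[u, c]) (w x * f x)%:E)%E.
pose V := (\int[lebesgue_measure]_(x in `[c, v]) (w x * f x)%:E)%E.
rewrite -/L -/V.
move=> /andP[lV Vu] /andP[lL Lu].
have mwf D : measurable D -> D `<=` `[u, v] -> measurable_fun D (fun x => w x * f x).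
  by move=> mD Duv; apply: measurable_funM => //; exact: measurable_funS muv.
have sub_uc : `]u, c[ `<=` `[u, v].
  by move=> x /=; rewrite !in_itv/= => /andP[ux xc]; rewrite (ltW ux) (le_trans (ltW xc)).
have sub_cv : `]c, v[ `<=` `[u, v].
  by move=> x /=; rewrite !in_itv/= => /andP[cx xv]; rewrite (ltW xv) (le_trans uc (ltW cx)).
pose phi x := `|c - x| `^ (r - 1) * Num.sg (c - x) * f x.
have mphi D : measurable D -> D `<=` `[u, v] -> measurable_fun D phi.
  move=> mD Duv; apply: measurable_funM; last exact: measurable_funS muv.
  apply: measurable_funM.
    by rewrite (_ : (fun x => _) = w)//; apply/funext => x; rewrite distrC.
  apply: measurableT_comp; first exact: measurable_sgr.
  exact: measurable_funB.
have EL : (\int[lebesgue_measure]_(x in `[u, c]) (phi x)%:E)%E = L.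
  apply: eq_integral_itv_bounded; [exact: mphi|exact: mwf|].
  move=> x; rewrite in_itv/= => /andP[_ xc].
  by rewrite /phi gtr0_sg ?subr_gt0 // mulr1 distrC.
have EV : (\int[lebesgue_measure]_(x in `[c, v]) (phi x)%:E)%E = (- V)%E.
  rewrite -integral_ge0N; last first.
    move=> x xcv; rewrite lee_fin mulr_ge0 ?powR_ge0 // ltW // fuv //.
    by move: xcv; rewrite /= !in_itv/= => /andP[cx ->]; rewrite (le_trans uc).
  apply: (eq_integral_itv_bounded (g := fun x => - (w x * f x))) => //.
  - exact: mphi.
  - by apply: measurableT_comp => //; exact: mwf.
  move=> x; rewrite in_itv/= => /andP[cx _].
  by rewrite /phi ltr0_sg ?subr_lt0 // mulrN1 distrC mulNr.
have LV : L = V.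
  move: stat; rewrite (integral_itv_split uc cv) ?EL ?EV; last first.
    by apply/measurable_EFinP; exact: mphi.
  move: lL Lu lV Vu; case: (L) => [l| |]; case: (V) => [y| |] //= _ _ _ _.
  by rewrite -EFinB => -[/eqP]; rewrite subr_eq0 => /eqP ->.
have key h1 h2 : 0 <= h1 -> 0 <= h2 -> h1 + h2 = v - u ->
    f c * expR (- (k * h1)) * (h1 `^ r / r) <= f c * expR (k * h2) * (h2 `^ r / r) ->
    h1 <= expR (k / r * (v - u)) * h2.
  move=> h10 h20 <- H; rewrite leNgt; apply/negP => lt.
  have := gt0_ltr_powR r0 _ _ lt.
  rewrite !nnegrE mulr_ge0 ?expR_ge0 // => /(_ isT h10).
  rewrite ltNge powRM ?expR_ge0 // -expRM mulrAC divfK ?gt_eqF //.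
  move=> /negP; apply.
  move: H; rewrite -!mulrA ler_pM2l // !mulrA ler_pM2r ?invr_gt0 // => H.
  by rewrite mulrDr expRD -mulrA -ler_pdivrMl ?expR_gt0 // -expRN.
split; apply: key; rewrite ?subr_ge0 //.
- by rewrite addrC addrA subrK.
- by rewrite -lee_fin (le_trans lL) // LV.
- by rewrite addrA subrK.
- by rewrite -lee_fin (le_trans lV) // -LV.
Qed.

(** * Sums over half-cells *)

(** Subdivisions of the interval into [m] cells, each cut in two by a
distinguished point, the one of odd index. Both the Voronoi cells of a quantizer
and the quantiles used to build a good one are of this kind. *)
Definition half_cells (R : realType) (a b : R) (m : nat) (p : nat -> R) : Prop :=
  [/\ p 0%N = a, p m.*2 = b & forall j, (j < m.*2)%N -> p j <= p j.+1].

Definition center (R : realType) (p : nat -> R) j : R := p j./2.*2.+1.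
Definition gap (R : realType) (p : nat -> R) j : R := p j.+1 - p j.

Section half_cells.
Context {R : realType}.
Variables (a b : R) (m : nat) (p : nat -> R).
Hypothesis pP : half_cells a b m p.
Implicit Types (g f : R -> R) (D : R -> \bar R).
Local Notation mu := (@lebesgue_measure R).

Lemma half_cells_le i j : (i <= j)%N -> (j <= m.*2)%N -> p i <= p j.
Proof.
have [_ _ pS] := pP; elim: j => [|j IHj]; first by rewrite leqn0 => /eqP->.
rewrite leq_eqVlt => /predU1P[->//|ij jm].
by apply: le_trans (pS _ jm); apply: IHj => //; exact: ltnW.
Qed.

Lemma half_cells_ge_a j : (j <= m.*2)%N -> a <= p j.
Proof. by have [<- _ _] := pP; exact: half_cells_le. Qed.

Lemma half_cells_le_b j : (j <= m.*2)%N -> p j <= b.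
Proof. by have [_ <- _] := pP => jm; exact: half_cells_le. Qed.

Lemma gap_ge0 j : (j < m.*2)%N -> 0 <= gap p j.
Proof. by have [_ _ pS] := pP; move=> /pS; rewrite subr_ge0. Qed.

Lemma sum_gap : \sum_(j < m.*2) gap p j = b - a.
Proof. by have [<- <- _] := pP; rewrite -telescope_sumr // big_mkord. Qed.

Lemma center_end j : center p j = p j \/ center p j = p j.+1.
Proof.
rewrite /center; have := odd_double_half j; case: (odd j) => /= E.
  by left; rewrite -[in RHS]E.
by right; rewrite -[in RHS]E.
Qed.

Lemma center_itv j : (j < m.*2)%N -> center p j \in `[p j, p j.+1].
Proof.
have [_ _ pS] := pP => /pS pj.
by have [->|->] := center_end j; rewrite in_itv/= lexx ?pj.
Qed.

Lemma center_in j : (j < m.*2)%N -> center p j \in `[a, b].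
Proof.
move=> jm; move: (center_itv jm); rewrite !in_itv/= => /andP[h1 h2].
rewrite (le_trans _ h1) ?half_cells_ge_a // 1?ltnW //.
by rewrite (le_trans h2) // half_cells_le_b.
Qed.

Section sums.
Variables (k H : R) (g : R -> R).
Hypotheses (k0 : 0 <= k) (gab : log_lipschitz k a b g).
Hypothesis gapH : forall j, (j < m.*2)%N -> gap p j <= H.

Let gcell j : (j < m.*2)%N -> log_lipschitz k (p j) (p j.+1) g.
Proof.
by move=> jm; apply: log_lipschitzS gab; [apply: half_cells_ge_a|apply: half_cells_le_b] => //; exact: ltnW.
Qed.

Let g0 j : (j < m.*2)%N -> 0 < g (center p j).
Proof. by move=> jm; have [_ + _] := gab; apply; exact: center_in. Qed.

Lemma half_cells_riemann_sum :
  ((expR (- (k * H)) * \sum_(j < m.*2) g (center p j) * gap p j)%:E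
    <= \int[mu]_(x in `[a, b]) (g x)%:E
    <= (expR (k * H) * \sum_(j < m.*2) g (center p j) * gap p j)%:E)%E.
Proof.
have [p0 pm pS] := pP.
have mg : measurable_fun `[p 0%N, p m.*2] (fun x => (g x)%:E).
  by rewrite p0 pm; apply/measurable_EFinP; case: gab.
rewrite -[in X in integral _ X _]p0 -[in X in integral _ X _]pm.
rewrite (integral_itv_cells pS mg) !mulr_sumr -!sumEFin.
have cell (j : 'I_m.*2) :
   ((g (center p j) * expR (- (k * gap p j)) * gap p j)%:E
     <= \int[mu]_(x in `[p j, p j.+1]) (g x)%:E
     <= (g (center p j) * expR (k * gap p j) * gap p j)%:E)%E.
  exact: (log_lipschitz_integral1 k0 (gcell (ltn_ord j)) (center_itv (ltn_ord j))).
apply/andP; split; apply: lee_sum => j _; have /andP[lo hi] := cell j.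
  apply: le_trans lo; rewrite lee_fin mulrCA mulrA.
  rewrite ler_wpM2r ?gap_ge0 // ler_wpM2l ?(ltW (g0 _)) //.
  by rewrite ler_expR lerN2 ler_wpM2l ?gapH.
apply: (le_trans hi); rewrite lee_fin [leRHS]mulrCA [leRHS]mulrA.
rewrite ler_wpM2r ?gap_ge0 // ler_wpM2l ?(ltW (g0 _)) //.
by rewrite ler_expR ler_wpM2l ?gapH.
Qed.

Variables (s : R) (D : R -> \bar R).
Hypotheses (s0 : 0 < s) (mD : measurable_fun setT D) (D0 : forall x, (0 <= D x)%E).

Let energy := \sum_(j < m.*2) g (center p j) * gap p j `^ (s + 1).

Let s1 : 0 < s + 1. Proof. by rewrite addr_gt0. Qed.

Let kernel_cell (j : 'I_m.*2) :
  ((g (center p j) * expR (- (k * gap p j)) * (gap p j `^ (s + 1) / (s + 1)))%:E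
     <= \int[mu]_(x in `[p j, p j.+1]) (`|x - center p j| `^ s * g x)%:E
     <= (g (center p j) * expR (k * gap p j) * (gap p j `^ (s + 1) / (s + 1)))%:E)%E.
Proof.
have [_ _ pS] := pP.
have cI := integral_dist_powR s1 (pS _ (ltn_ord j)) (center_end j).
rewrite addrK in cI.
apply: (log_lipschitz_integral (w := fun x => `|x - center p j| `^ s)) => //.
- exact: gcell.
- exact: center_itv.
- exact: measurable_dist_powR.
Qed.

Let mDg (u v : R) : a <= u -> v <= b ->
  measurable_fun `[u, v] (fun x => (D x * (g x)%:E)%E).
Proof.
move=> au vb; apply: emeasurable_funM; first exact: measurable_funTS.
by apply/measurable_EFinP; case: (log_lipschitzS au vb gab).
Qed.

Let mker (j : 'I_m.*2) : measurable_fun `[p j, p j.+1]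
  (fun x => (`|x - center p j| `^ s * g x)%:E).
Proof.
apply/measurable_EFinP; apply: measurable_funM; first exact: measurable_dist_powR.
by case: (gcell (ltn_ord j)).
Qed.

Let split_cells : (\int[mu]_(x in `[a, b]) (D x * (g x)%:E) =
  \sum_(j < m.*2) \int[mu]_(x in `[p j, p j.+1]) (D x * (g x)%:E))%E.
Proof.
have [p0 pm pS] := pP; rewrite -(integral_itv_cells pS) p0 pm //.
exact: mDg.
Qed.

Let gx0 (j : 'I_m.*2) x : x \in `[p j, p j.+1] -> 0 <= g x.
Proof. by move=> xj; case: (gcell (ltn_ord j)) => _ + _ => /(_ _ xj)/ltW. Qed.

Let mDcell (j : 'I_m.*2) :
  measurable_fun `[p j, p j.+1] (fun x => (D x * (g x)%:E)%E).
Proof.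
by apply: mDg; [apply: half_cells_ge_a; exact: ltnW|exact: half_cells_le_b].
Qed.

Lemma half_cells_energy_ge :
  (forall (j : 'I_m.*2) x, x \in `[p j, p j.+1] ->
     ((`|x - center p j| `^ s)%:E <= D x)%E) ->
  ((expR (- (k * H)) * (energy / (s + 1)))%:E
     <= \int[mu]_(x in `[a, b]) (D x * (g x)%:E))%E.
Proof.
move=> DP; rewrite split_cells mulr_suml mulr_sumr -sumEFin.
apply: lee_sum => j _; have /andP[lo _] := kernel_cell j.
apply: le_trans (le_trans lo _).
  rewrite lee_fin -!mulrA mulrCA ler_wpM2l ?(ltW (g0 _)) //.
  rewrite ler_wpM2r ?mulr_ge0 ?powR_ge0 ?invr_ge0 ?(ltW s1) //.
  by rewrite ler_expR lerN2 ler_wpM2l ?gapH.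
apply: ge0_le_integral => //=.
- by move=> x /gx0 gx; rewrite lee_fin mulr_ge0 ?powR_ge0.
- exact: mker.
- exact: mDcell.
- by move=> x xj; rewrite EFinM lee_wpmul2r ?lee_fin ?(gx0 xj) ?DP.
Qed.

Lemma half_cells_energy_le :
  (forall (j : 'I_m.*2) x, x \in `[p j, p j.+1] ->
     (D x <= (`|x - center p j| `^ s)%:E)%E) ->
  (\int[mu]_(x in `[a, b]) (D x * (g x)%:E)
     <= (expR (k * H) * (energy / (s + 1)))%:E)%E.
Proof.
move=> DP; rewrite split_cells mulr_suml mulr_sumr -sumEFin.
apply: lee_sum => j _; have /andP[_ hi] := kernel_cell j.
apply: le_trans (le_trans _ hi) _; last first.
  rewrite lee_fin -!mulrA [leRHS]mulrCA ler_wpM2l ?(ltW (g0 _)) //.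
  rewrite ler_wpM2r ?mulr_ge0 ?powR_ge0 ?invr_ge0 ?(ltW s1) //.
  by rewrite ler_expR ler_wpM2l ?gapH.
apply: ge0_le_integral => //=.
- by move=> x /gx0 gx; rewrite mule_ge0 ?lee_fin.
- exact: mDcell.
- exact: mker.
- by move=> x xj; rewrite EFinM lee_wpmul2r ?lee_fin ?(gx0 xj) ?DP.
Qed.

End sums.

(** The exponents of the ratios of neighbours telescope: their sum is at most
[2 * q] times the length of the interval, whatever the number of cells. *)
Lemma gaps_comparable q : 0 <= q ->
  (forall j, (j.+1 < m.*2)%N ->
     gap p j <= expR (q * (gap p j + gap p j.+1)) * gap p j.+1 /\
     gap p j.+1 <= expR (q * (gap p j + gap p j.+1)) * gap p j) ->
  forall i j, (i < m.*2)%N -> (j < m.*2)%N ->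
    gap p i <= expR (2 * q * (b - a)) * gap p j.
Proof.
move=> q0 nb.
(* The exponent is the sum of the neighbouring exponents between [i] and [j]. *)
pose E i j := expR (q * (p j.+1 + p j - p i - p i.+1)).
have chain i d : (i + d < m.*2)%N ->
    gap p i <= E i (i + d)%N * gap p (i + d)%N /\
    gap p (i + d)%N <= E i (i + d)%N * gap p i.
  elim: d => [|d IHd] idm.
    rewrite addn0 in idm *; rewrite /E (_ : _ - _ - _ = 0); last by ring.
    by rewrite mulr0 expR0 !mul1r.
  rewrite addnS in idm *; have [h1 h2] := IHd (ltnW idm).
  have [n1 n2] := nb _ idm.
  have Emul : E i (i + d).+1 =
      E i (i + d)%N * expR (q * (gap p (i + d)%N + gap p (i + d).+1)).
    by rewrite /E -expRD; congr expR; rewrite /gap; ring.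
  rewrite Emul; split.
    by rewrite (le_trans h1) // -mulrA ler_wpM2l ?expR_ge0.
  by rewrite (le_trans n2) // [E i _ * _]mulrC -mulrA ler_wpM2l ?expR_ge0.
have Ebound i j : (i < m.*2)%N -> (j < m.*2)%N -> E i j <= expR (2 * q * (b - a)).
  move=> im jm; rewrite ler_expR -mulrA mulrCA ler_wpM2l //.
  have := half_cells_ge_a im; have := half_cells_ge_a (ltnW im).
  by have := half_cells_le_b jm; have := half_cells_le_b (ltnW jm); lra.
move=> i j im jm; have [ij|/ltnW ji] := leqP i j.
  have := chain i (j - i)%N; rewrite subnKC // => /(_ jm)[h _].
  by rewrite (le_trans h) // ler_wpM2r ?gap_ge0 ?Ebound.
have := chain j (i - j)%N; rewrite subnKC // => /(_ im)[_ h].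
by rewrite (le_trans h) // ler_wpM2r ?gap_ge0 ?Ebound.
Qed.

End half_cells.

(** * Half-cells of stationary quantizers and distortion *)

Section min_dist.
Context {R : realType}.
Implicit Types (A : {fset R}) (a b s x c : R).

Lemma min_dist_ge0 s A x : (0 <= min_dist s A x)%E.
Proof.
rewrite /min_dist; elim/big_rec: _ => [|c y _ y0]; first exact: leey.
by rewrite le_min y0 andbT lee_fin powR_ge0.
Qed.

Lemma measurable_min_dist s A : measurable_fun setT (min_dist s A).
Proof.
rewrite /min_dist; elim: (enum_fset A) => [|c t IHt].
  by under eq_fun do rewrite big_nil; exact: measurable_cst.
under eq_fun do rewrite big_cons.
by apply: measurable_mine => //; apply/measurable_EFinP; exact: measurable_dist_powR.
Qed.

Lemma node_half_cells a b A : A != fset0 -> [set` A] `<=` `[a, b] ->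
  half_cells a b #|` A| (node a b A).
Proof.
by move=> A0 Aab; split; [exact: node0|exact: node_last|exact: node_le].
Qed.

Lemma min_dist_node s a b A j x : 0 < s -> [set` A] `<=` `[a, b] ->
  (j < #|` A|.*2)%N -> x \in `[node a b A j, node a b A j.+1] ->
  min_dist s A x = (`|x - center (node a b A) j| `^ s)%:E.
Proof.
move=> s0 Aab jA xj; have kA : (j./2 < #|` A|)%N by rewrite ltn_half_double.
rewrite /center node_odd; apply: (@min_distE _ a b) => //.
have le2 : node a b A j./2.*2 <= node a b A j./2.*2.+1.
  by apply: node_le => //; rewrite ltn_double.
have le3 : node a b A j./2.*2.+1 <= node a b A j./2.*2.+2.
  by apply: node_le => //; rewrite -doubleS leq_double.
move: xj; rewrite -[in X in X -> _](odd_double_half j) !in_itv/=.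
case: (odd j) => /andP[x1 x2]; apply/andP; split => //.
- exact: le_trans x1.
- exact: le_trans le3.
Qed.

End min_dist.

(** Across a point two neighbouring half-cells are tied by stationarity; across a
boundary they have the same length, the boundary being a midpoint. *)
Lemma stationary_gaps (R : realType) (k a b r : R) (f : R -> R) (A : {fset R}) :
  0 <= k -> log_lipschitz k a b f -> 0 < r -> A != fset0 ->
  stationary a b f r A ->
  forall i j, (i < #|` A|.*2)%N -> (j < #|` A|.*2)%N ->
    gap (node a b A) i <= expR (2 * (k / r) * (b - a)) * gap (node a b A) j.
Proof.
move=> k0 fab r0 A0 [Aab stat].
have hc := node_half_cells A0 Aab.
have q0 : 0 <= k / r by rewrite divr_ge0 // ltW.
apply: (gaps_comparable hc q0) => j jA.
have g0 := gap_ge0 hc (ltnW jA); have g1 := gap_ge0 hc jA.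
have := odd_double_half j; case: (odd j) => /= /esym Ej.
  have Eg : gap (node a b A) j = gap (node a b A) j.+1.
    have kA : (j./2.+1 < #|` A|)%N by rewrite -ltn_double doubleS; move: jA; rewrite {1}Ej add1n.
    rewrite /gap Ej !add1n -doubleS !node_odd /node odd_double double_eq0 /= doubleK.
    by rewrite (ltn_eqF kA); field.
  have le1 : 1 <= expR (k / r * (gap (node a b A) j + gap (node a b A) j.+1)).
    by rewrite -expR0 ler_expR mulr_ge0 // addr_ge0.
  by rewrite -Eg in le1 g1 *; split; rewrite ler_peMl.
rewrite add0n in Ej.
have kA : (j./2 < #|` A|)%N by rewrite -ltn_double -Ej ltnW.
have := stat _ kA; rewrite (voronoi_cellE a b kA) -(node_odd a b) -Ej.
move=> /(stationary_half_cells k0 fab r0 _ _ _ _).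
have [_ _ pS] := hc; rewrite (pS _ jA) (pS _ (ltnW jA)).
rewrite (half_cells_ge_a hc) ?(half_cells_le_b hc) //; last by rewrite ltnW // ltnW.
move=> /(_ isT isT isT isT).
by rewrite /gap (_ : node a b A j.+1 - _ + _ = node a b A j.+2 - node a b A j) //; ring.
Qed.

Section has_density.
Context {R : realType}.
Variables (k a b : R) (f : R -> R) (P : probability (measurableTypeR R) R).
Hypotheses (fab : log_lipschitz k a b f) (hP : has_density P a b f).

Lemma distortion_density s A : (distortion P s A =
  \int[lebesgue_measure]_(x in `[a, b]) (min_dist s A x * (f x)%:E))%E.
Proof.
have [mf f0 _] := fab.
rewrite /distortion (integral_has_density hP mf) ?setTI //.
- by move=> x /f0/ltW.
- exact: measurable_min_dist.
- exact: min_dist_ge0.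
Qed.

Lemma integral_min_dist_density s A : (\int[P]_(x in `[a, b]) min_dist s A x =
  \int[lebesgue_measure]_(x in `[a, b]) (min_dist s A x * (f x)%:E))%E.
Proof.
have [mf f0 _] := fab.
rewrite (integral_has_density hP mf) ?setIid //.
- by move=> x /f0/ltW.
- exact: measurable_min_dist.
- exact: min_dist_ge0.
Qed.

Lemma quantization_error_powR_le n s A : 0 < s -> A != fset0 -> (#|` A| <= n)%N ->
  (quantization_error n s P `^ s <= distortion P s A)%E.
Proof.
move=> s0 A0 An.
have D0 : (0 <= distortion P s A)%E.
  by apply: integral_ge0 => x _; exact: min_dist_ge0.
rewrite -[leRHS]poweRe1 // -(mulVf (lt0r_neq0 s0)) poweRrM.
apply: gt0_ler_poweR; rewrite ?(ltW s0) // ?in_itv /= ?leey ?andbT ?poweR_ge0 //.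
  by apply: le_ereal_inf_tmp => _ [B _ <-]; exact: poweR_ge0.
by apply: ereal_inf_lbound; exists A.
Qed.

End has_density.

(** * An upper bound for the optimal error *)

Lemma log_lipschitz_le (R : realType) (k a b x y : R) (g : R -> R) : 0 <= k ->
  log_lipschitz k a b g -> x \in `[a, b] -> y \in `[a, b] ->
  g x <= g y * expR (k * (b - a)).
Proof.
move=> k0 [_ g0 gk] xab yab; apply: (le_trans (gk _ _ xab yab)).
rewrite ler_wpM2l ?(ltW (g0 _ yab)) // ler_expR ler_wpM2l //.
move: xab yab; rewrite !in_itv/= => /andP[? ?] /andP[? ?].
by rewrite ler_norml; apply/andP; split; lra.
Qed.

Lemma log_lipschitz_integral_gt0 (R : realType) (k a b : R) (g : R -> R) :
  0 <= k -> a < b -> log_lipschitz k a b g ->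
  exists2 I, 0 < I & (\int[lebesgue_measure]_(x in `[a, b]) (g x)%:E = I%:E)%E.
Proof.
move=> k0 ab gab.
have aab : a \in `[a, b] by rewrite in_itv/= lexx ltW.
have [_ g0 _] := gab.
have /andP[] := log_lipschitz_integral1 k0 gab aab.
case: (integral _ _ _) => [I| |] //= lo _; exists I => //; move: lo; rewrite lee_fin; apply: lt_le_trans.
by rewrite !mulr_gt0 ?expR_gt0 ?g0 ?subr_gt0.
Qed.

(** Quantiles of [w], by the intermediate value theorem for its primitive. *)
Lemma equal_mass_nodes (R : realType) (k a b I : R) (w : R -> R) (m : nat) :
  a < b -> log_lipschitz k a b w -> (0 < m)%N -> 0 < I ->
  (\int[lebesgue_measure]_(x in `[a, b]) (w x)%:E = I%:E)%E ->
  exists p : nat -> R, [/\ p 0%N = a, p m = b &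
    forall j, (j < m)%N -> [/\ a <= p j, p j <= p j.+1, p j.+1 <= b &
     (\int[lebesgue_measure]_(x in `[p j, p j.+1]) (w x)%:E = (I / m%:R)%:E)%E]].
Proof.
move=> ab [mw w0 _] m0 I0 wI.
have mwE : measurable_fun `[a, b] (fun x => (w x)%:E) by apply/measurable_EFinP.
have iw : lebesgue_measure.-integrable `[a, b] (EFin \o w).
  apply/integrableP; split; first exact: mwE.
  have -> : (\int[lebesgue_measure]_(x in `[a, b]) `|(EFin \o w) x| = I%:E)%E.
    rewrite -wI; apply: eq_integral => x /set_mem /= xab.
    by rewrite ger0_norm // ltW // w0.
  exact: ltry.
pose G x := fine (\int[lebesgue_measure]_(t in `[a, x]) (w t)%:E)%E.
have cG : {within `[a, b], continuous G}.
  exact: (parameterized_integral_continuous (ltW ab) iw).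
have Gfin x : x \in `[a, b] -> (\int[lebesgue_measure]_(t in `[a, x]) (w t)%:E = (G x)%:E)%E.
  move=> xab; rewrite fineK //; apply: integrable_fin_num => //.
  apply: integrableS iw => // t; move: xab; rewrite /= !in_itv/=.
  by move=> /andP[_ xb] /andP[-> tx]; exact: le_trans xb.
have Gab u v : u \in `[a, b] -> v \in `[a, b] -> u <= v ->
    (\int[lebesgue_measure]_(t in `[u, v]) (w t)%:E = (G v - G u)%:E)%E.
  move=> uab vab uv; have au : a <= u by move: uab; rewrite in_itv => /andP[].
  have := Gfin v vab; rewrite (integral_itv_split au uv); last first.
    apply: measurable_funS mwE => // t; move: vab; rewrite /= !in_itv/=.
    by move=> /andP[_ xb] /andP[-> tx]; exact: le_trans xb.
  rewrite Gfin //; case: (integral _ _ _) => [y| |] //.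
  by rewrite -EFinD => -[<-]; rewrite addrC addKr.
have Gle u v : u \in `[a, b] -> v \in `[a, b] -> u <= v -> G u <= G v.
  move=> uab vab uv; rewrite -subr_ge0 -lee_fin -Gab //.
  apply: integral_ge0 => t /= tuv; rewrite lee_fin ltW // w0 //.
  move: uab vab tuv; rewrite !in_itv/= => /andP[au _] /andP[_ vb] /andP[ut tv].
  by rewrite (le_trans au) // (le_trans tv).
have aab : a \in `[a, b] by rewrite in_itv/= lexx ltW.
have bab : b \in `[a, b] by rewrite in_itv/= lexx ltW.
have Ga : G a = 0 by rewrite /G set_itv1 integral_set1.
have Gb : G b = I by rewrite /G wI.
have node_ex (j : nat) : exists x : R, (j <= m)%N ->
    [/\ x \in `[a, b], G x = I * (j%:R / m%:R), (j = 0%N -> x = a) & (j = m -> x = b)].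
  have [->|j0] := eqVneq j 0%N.
    exists a => _; split => //; first by rewrite Ga mul0r mulr0.
    by move=> m00; rewrite -m00 in m0.
  have [->|jm] := eqVneq j m.
    exists b => _; split => //; first by rewrite Gb divff ?mulr1 // pnatr_eq0 -lt0n.
    by move=> m00; rewrite m00 in m0.
  have [jlem|jgm] := leqP j m; last by exists a.
  have [] := @IVT R G a b (I * (j%:R / m%:R)) (ltW ab) cG.
    rewrite Ga Gb min_l ?max_r ?(ltW I0) //; apply/andP; split.
      by rewrite mulr_ge0 ?divr_ge0 // ltW.
    by rewrite ler_piMr ?(ltW I0) // ler_pdivrMr ?ltr0n // mul1r ler_nat.
  move=> x xab Gx; exists x => _; split => // jE.
    by rewrite jE in j0.
  by rewrite jE eqxx in jm.
have [p pP] := choice node_ex; exists p.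
have [_ _ p0 _] := pP 0%N (leq0n _); have [_ _ _ pm] := pP m (leqnn _).
split; [exact: p0|exact: pm|] => j jm.
have [pj Gj _ _] := pP j (ltnW jm); have [pj1 Gj1 _ _] := pP j.+1 jm.
have dG : G (p j.+1) - G (p j) = I / m%:R.
  by rewrite Gj Gj1 -mulrBr -mulrBl -natrB // subSnn mul1r.
have pjj : p j <= p j.+1.
  rewrite leNgt; apply/negP => /ltW/(Gle _ _ pj1 pj).
  by rewrite -subr_le0 dG leNgt divr_gt0 // ltr0n.
by move: (pj) (pj1); rewrite !in_itv/= => /andP[-> _] /andP[_ ->]; rewrite Gab // dG.
Qed.

(** The competitor puts its points at the odd ones among the quantiles of order
[j / (2 n)] of [w = f `^ (r + 1)^-1]. Up to a factor [exp (C / n)] each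
half-cell of length [h] then has [w * h = I / (2 n)], so that all of them
contribute equally to the distortion, [f * h `^ (r + 1)] being
[(w * h) `^ (r + 1)]. *)
Lemma quantization_error_upper (R : realType) (k a b r I : R) (f : R -> R)
    (P : probability (measurableTypeR R) R) :
  0 <= k -> a < b -> log_lipschitz k a b f -> has_density P a b f -> 0 < r ->
  0 < I ->
  (\int[lebesgue_measure]_(x in `[a, b]) (f x `^ (r + 1)^-1)%:E = I%:E)%E ->
  exists2 C, 0 <= C & forall n, (0 < n)%N ->
    (quantization_error n r P `^ r <=
      (expR (C / n%:R) * (I * (I / n.*2%:R) `^ r / (r + 1)))%:E)%E.
Proof.
move=> k0 ab fab hP r0 I0 wI.
have r1 : 0 < r + 1 by rewrite addr_gt0.
pose w x := f x `^ (r + 1)^-1; pose kw := k * `|(r + 1)^-1|.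
have kw0 : 0 <= kw by rewrite mulr_ge0.
have wab : log_lipschitz kw a b w by exact: log_lipschitz_powR.
have [mw w0 _] := wab; have [mf f0 _] := fab.
have kwr : kw * (r + 1) = k.
  by rewrite /kw gtr0_norm ?invr_gt0 // mulfVK ?gt_eqF.
have aab : a \in `[a, b] by rewrite in_itv/= lexx ltW.
(* [C1 / n] bounds the lengths: [C1] is, up to an exponential factor, the mass of
   a half-cell times [n], divided by a lower bound of the density. *)
pose C1 := expR (kw * (b - a)) * (I / 2) / (w a * expR (- (kw * (b - a)))).
have C10 : 0 <= C1.
  by rewrite divr_ge0 ?mulr_ge0 ?expR_ge0 ?divr_ge0 ?(ltW I0) ?(ltW (w0 _ aab)).
exists (2 * k * C1); first by rewrite mulr_ge0 // mulr_ge0.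
move=> n n0; have n20 : (0 < n.*2)%N by rewrite double_gt0.
have [p [p0 pm pP]] := equal_mass_nodes ab wab n20 I0 wI.
have pS j : (j < n.*2)%N -> p j <= p j.+1 by move=> /pP[].
have hc : half_cells a b n p by [].
have nR0 : 0 < n%:R :> R by rewrite ltr0n.
have n2E : n.*2%:R = 2 * n%:R :> R by rewrite -mul2n natrM.
pose H := C1 / n%:R.
have cellw j : (j < n.*2)%N ->
    w (center p j) * gap p j <= expR (kw * gap p j) * (I / n.*2%:R).
  move=> jn; have [apj pj pb mass] := pP j jn.
  have wcell : log_lipschitz kw (p j) (p j.+1) w by exact: log_lipschitzS wab.
  have := log_lipschitz_integral1 kw0 wcell (center_itv hc jn).
  rewrite mass => /andP[+ _].
  rewrite lee_fin expRN mulrAC ler_pdivrMr ?expR_gt0 // => lo.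
  by rewrite mulrC [leRHS]mulrC mulrC.
have gapH j : (j < n.*2)%N -> gap p j <= H.
  move=> jn; have g0 := gap_ge0 hc jn.
  have gba : gap p j <= b - a.
    by apply: lerB; [apply: (half_cells_le_b hc)|apply: (half_cells_ge_a hc);
      exact: ltnW].
  have wa : w a * expR (- (kw * (b - a))) <= w (center p j).
    rewrite expRN ler_pdivrMr ?expR_gt0 //.
    exact: (log_lipschitz_le kw0 wab aab (center_in hc jn)).
  rewrite /H /C1 mulrAC ler_pdivlMr ?mulr_gt0 ?expR_gt0 ?(w0 _ aab) //.
  rewrite mulrC (le_trans (ler_wpM2r g0 wa)) // (le_trans (cellw j jn)) //.
  rewrite -[leRHS]mulrA n2E invfM [I * (_ * _)]mulrA.
  by rewrite ler_wpM2r ?mulr_ge0 ?invr_ge0 ?(ltW I0) ?(ltW nR0) // ler_expR ler_wpM2l.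
pose A : {fset R} := seq_fset tt [seq p i.*2.+1 | i <- iota 0 n].
have Ap i : (i < n)%N -> p i.*2.+1 \in A.
  by move=> ni; rewrite seq_fsetE; apply/mapP; exists i; rewrite ?mem_iota.
have A0 : A != fset0.
  by apply/eqP => AE; have := Ap 0%N n0; rewrite AE inE.
have An : (#|` A| <= n)%N.
  by rewrite size_seq_fset (leq_trans (size_undup _)) // size_map size_iota.
apply: (le_trans (quantization_error_powR_le P r0 A0 An)).
rewrite (distortion_density fab hP).
apply: (le_trans (half_cells_energy_le hc k0 fab gapH r0 _ _ _)).
- exact: measurable_min_dist.
- by move=> x; exact: min_dist_ge0.
- move=> j x xj; apply: min_dist_le; apply: Ap.
  by rewrite ltn_half_double.
rewrite lee_fin.
have term j : (j < n.*2)%N -> f (center p j) * gap p j `^ (r + 1) <=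
    expR (k * H) * ((I / n.*2%:R) * (I / n.*2%:R) `^ r).
  move=> jn; have cab := center_in hc jn; have g0 := gap_ge0 hc jn.
  have In0 : 0 <= I / n.*2%:R by rewrite divr_ge0 ?(ltW I0).
  have -> : f (center p j) = w (center p j) `^ (r + 1).
    by rewrite -powRrM mulVf ?gt_eqF // powRr1 // ltW // f0.
  rewrite -powRM ?(ltW (w0 _ cab)) //.
  have -> : I / n.*2%:R * (I / n.*2%:R) `^ r = (I / n.*2%:R) `^ (r + 1).
    by rewrite powRD ?powRr1 // 1?mulrC // (gt_eqF r1).
  rewrite -kwr mulrAC expRM -powRM ?expR_ge0 //.
  apply: ge0_ler_powR; rewrite ?nnegrE ?mulr_ge0 ?expR_ge0 ?(ltW (w0 _ cab)) ?(ltW r1) ?(ltW I0) //.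
  apply: (le_trans (cellw j jn)); rewrite ler_wpM2r // ler_expR ler_wpM2l //.
  exact: gapH.
have -> : 2 * k * C1 / n%:R = k * H + k * H by rewrite /H; ring.
rewrite expRD -mulrA ler_wpM2l ?expR_ge0 // mulrA ler_wpM2r ?invr_ge0 ?(ltW r1) //.
apply: (@le_trans _ _ (\sum_(j < n.*2) expR (k * H) * ((I / n.*2%:R) * (I / n.*2%:R) `^ r))).
  by apply: ler_sum => j _; exact: term.
rewrite sumr_const card_ord -mulr_natl.
by rewrite le_eqVlt; apply/orP; left; apply/eqP; field; rewrite pnatr_eq0 -lt0n n20.
Qed.

(** * The constant of the uniform distribution *)

Section uniform.
Context {R : realType}.
Implicit Types (s c x H : R) (A : {fset R}).
Local Notation mu := (@lebesgue_measure R).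

(** What a point at [c] saves at [x] with respect to the constant error
[H `^ s]. *)
Definition saving s H c x : R := Num.max 0 (H `^ s - `|x - c| `^ s).

Lemma saving_ge0 s H c x : 0 <= saving s H c x.
Proof. by rewrite /saving le_max lexx. Qed.

Lemma measurable_saving s H c (D : set R) : measurable_fun D (saving s H c).
Proof.
apply: measurable_maxr => //; apply: measurable_funB => //.
exact: measurable_dist_powR.
Qed.

Lemma integral_saving_le s H c : 0 < s -> 0 < H ->
  (\int[mu]_(x in `[0%R, 1%R]) (saving s H c x)%:E
    <= (2 * (H `^ s * H * (s / (s + 1))))%:E)%E.
Proof.
move=> s0 H0; have s1 : 0 < s + 1 by rewrite addr_gt0.
have mS D : measurable_fun D (fun x => (saving s H c x)%:E).
  by apply/measurable_EFinP; exact: measurable_saving.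
apply: (@le_trans _ _ (\int[mu]_x (saving s H c x)%:E)%E).
  apply: ge0_subset_integral => //; first exact: mS.
  by move=> x _; rewrite lee_fin saving_ge0.
pose lo := c - H; pose hi := c + H.
have -> : (\int[mu]_x (saving s H c x)%:E =
    \int[mu]_(x in `[lo, hi]) (saving s H c x)%:E)%E.
  rewrite [RHS]integral_mkcond; apply: eq_integral => x _.
  rewrite patchE; case: ifPn => // /negP xcH; congr EFin.
  rewrite /saving max_l // subr_le0; apply: ge0_ler_powR; rewrite ?nnegrE ?(ltW s0) ?(ltW H0) //.
  rewrite leNgt; apply/negP => xc; apply: xcH; rewrite inE /= in_itv /= /lo /hi.
  by move: xc; rewrite ltr_norml => /andP[? ?]; apply/andP; split; lra.
have half u v : v - u = H -> c = u \/ c = v ->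
    (\int[mu]_(x in `[u, v]) (saving s H c x)%:E = (H `^ s * H * (s / (s + 1)))%:E)%E.
  move=> vuH cuv; have uv : u <= v by rewrite -subr_ge0 vuH ltW.
  have eH : (\int[mu]_(x in `[u, v]) (saving s H c x)%:E +
      \int[mu]_(x in `[u, v]) (`|x - c| `^ s)%:E = (H `^ s * H)%:E)%E.
    rewrite -ge0_integralD //=; last 3 first.
    - by move=> x _; rewrite lee_fin saving_ge0.
    - exact: mS.
    - by apply/measurable_EFinP; exact: measurable_dist_powR.
    rewrite (eq_integral (fun=> (H `^ s)%:E)).
      rewrite integral_cst //= lebesgue_measure_itv /= lte_fin.
      by rewrite -subr_gt0 vuH H0 -EFinB vuH.
    move=> x /set_mem /= xuv; rewrite -EFinD; congr EFin; rewrite /saving max_r ?subrK //.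
    rewrite subr_ge0; apply: ge0_ler_powR; rewrite ?nnegrE ?(ltW s0) ?(ltW H0) //.
    move: xuv; rewrite in_itv /= => /andP[ux xv].
    by rewrite -vuH; case: cuv => ->; rewrite ler_norml; apply/andP; split; lra.
  have := integral_dist_powR s1 uv cuv; rewrite addrK vuH => E.
  move: eH; rewrite E; case: (integral _ _ _) => [y| |] //.
  rewrite -EFinD => -[yE]; congr EFin.
  have -> : y = H `^ s * H - H `^ (s + 1) / (s + 1) by rewrite -yE addrK.
  rewrite powRD ?powRr1 ?(ltW H0) //; last by rewrite (gt_eqF s1).
  by field; rewrite gt_eqF.
have loc : lo <= c by rewrite /lo; lra.
have chi : c <= hi by rewrite /hi; lra.
rewrite (integral_itv_split loc chi (mS _)) (half lo c) ?(half c hi).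
- by rewrite -EFinD lee_fin; lra.
- by rewrite /hi; ring.
- by left.
- by rewrite /lo; ring.
- by right.
Qed.

(** The constant error [H `^ s] is at most the error plus the sum of the savings,
and the bound on the integral of a saving does not depend on its point. Summing over
points rather than over cells, with [H = 1 / (2 n)], gives a bound that the
midpoints of [n] equal intervals attain. *)
Lemma uniform_distortion_ge s n A : 0 < s -> (0 < n)%N -> (#|` A| <= n)%N ->
  (((n.*2%:R)^-1 `^ s / (s + 1))%:E <= distortion (uniform_prob (@ltr01 R)) s A)%E.
Proof.
move=> s0 n0 An; have s1 : 0 < s + 1 by rewrite addr_gt0.
pose H : R := (n.*2%:R)^-1; rewrite -/H.
have H0 : 0 < H by rewrite invr_gt0 ltr0n double_gt0.
rewrite /distortion integral_uniform; last 2 first.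
- exact: measurable_min_dist.
- exact: min_dist_ge0.
rewrite subr0 invr1 mul1e.
set D := (\int[_]_(x in _) _)%E.
have key : ((H `^ s)%:E <= D + (n%:R * (2 * (H `^ s * H * (s / (s + 1)))))%:E)%E.
  apply: (@le_trans _ _
    (D + \int[mu]_(x in `[0%R, 1%R]) (\sum_(c <- A) saving s H c x)%:E)%E); last first.
    apply: leeD2l; under eq_integral do rewrite -sumEFin.
    rewrite ge0_integral_sum //=; last 2 first.
    - by move=> c; apply/measurable_EFinP; exact: measurable_saving.
    - by move=> c x _; rewrite lee_fin saving_ge0.
    apply: (@le_trans _ _ (\sum_(c <- A) (2 * (H `^ s * H * (s / (s + 1))))%:E)%E).
      by apply: lee_sum => c _; exact: integral_saving_le.
    rewrite sumEFin lee_fin big_const_seq count_predT iter_addr_0 -[leLHS]mulr_natl.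
    apply: ler_wpM2r; last by rewrite ler_nat.
    by rewrite !mulr_ge0 ?powR_ge0 ?invr_ge0 ?(ltW s0) ?(ltW s1) ?(ltW H0).
  rewrite -ge0_integralD //=; last 4 first.
  - by move=> x _; exact: min_dist_ge0.
  - by apply: measurable_funTS; exact: measurable_min_dist.
  - by move=> x _; rewrite lee_fin; apply: sumr_ge0 => c _; exact: saving_ge0.
  - apply/measurable_EFinP; apply: measurable_sum => c; exact: measurable_saving.
  have -> : ((H `^ s)%:E = \int[mu]_(x in `[0%R, 1%R]) (H `^ s)%:E)%E.
    by rewrite integral_cst //= lebesgue_measure_itv /= lte_fin ltr01 -EFinB subr0 mule1.
  apply: ge0_le_integral => //=.
  - by move=> x _; rewrite lee_fin powR_ge0.
  - apply: emeasurable_funD; first by apply: measurable_funTS; exact: measurable_min_dist.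
    apply/measurable_EFinP; apply: measurable_sum => c; exact: measurable_saving.
  move=> x _; rewrite -leeBlDr //.
  apply: le_min_dist => c cA; rewrite -EFinB lee_fin (big_fsetD1 c) //=.
  rewrite opprD addrA lerBlDr ler_wpDr ?sumr_ge0 //.
    by move=> c' _; exact: saving_ge0.
  by rewrite lerBlDr -lerBlDl /saving le_max lexx orbT.
have nH : n%:R * H = 2^-1.
  rewrite /H -mul2n natrM invfM mulrCA mulfV ?mulr1 // pnatr_eq0 -lt0n //.
move: key; rewrite (_ : n%:R * _ = H `^ s * (s / (s + 1))); last first.
  rewrite [LHS](_ : _ = (n%:R * H) * 2 * (H `^ s * (s / (s + 1)))); last by ring.
  by rewrite nH mulVf // mul1r.
rewrite -leeBlDr // -EFinB; apply: le_trans; rewrite lee_fin le_eqVlt.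
by apply/orP; left; apply/eqP; field; rewrite gt_eqF.
Qed.

(** The infimum is attained by every [n]; for the upper bound a single midpoint is
enough. *)
Lemma JconstE s : 0 < s -> Jconst s = (2^-1 `^ s / (s + 1))%:E.
Proof.
move=> s0; have s1 : 0 < s + 1 by rewrite addr_gt0.
apply/eqP; rewrite eq_le; apply/andP; split.
  apply: ge_ereal_inf; eexists; first by exists 1%N.
  rewrite powR1 mul1e.
  have A0 : [fset 2^-1 : R]%fset != fset0.
    by apply/fset0Pn; exists 2^-1; rewrite inE.
  apply: (le_trans (quantization_error_powR_le _ s0 A0 _)).
    by rewrite cardfs1.
  rewrite /distortion integral_uniform; last 2 first.
  - exact: measurable_min_dist.
  - exact: min_dist_ge0.
  rewrite subr0 invr1 mul1e.
  pose A : {fset R} := [fset 2^-1]%fset; rewrite -/A.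
  have -> : (\int[mu]_(x in `[0%R, 1%R]) min_dist s A x =
      \int[mu]_(x in `[0%R, 1%R]) (`|x - 2^-1%R| `^ s)%:E)%E.
    apply: eq_integral => x _; apply/eqP; rewrite eq_le min_dist_le ?inE //=.
    by apply: le_min_dist => c; rewrite inE => /eqP ->.
  have h1 : (0 : R) <= 2^-1 by rewrite invr_ge0.
  have h2 : 2^-1 <= (1 : R) by rewrite invf_le1 // ler1n.
  rewrite (integral_itv_split h1 h2); last first.
    by apply/measurable_EFinP; exact: measurable_dist_powR.
  have := integral_dist_powR s1 h1 (or_intror erefl); rewrite addrK => ->.
  have := integral_dist_powR s1 h2 (or_introl erefl); rewrite addrK => ->.
  rewrite -EFinD lee_fin subr0 (_ : 1 - 2^-1 = 2^-1 :> R); last by field.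
  rewrite -mulrDl ler_wpM2r ?invr_ge0 ?(ltW s1) //.
  rewrite powRD ?powRr1 ?(gt_eqF s1) //.
  by rewrite le_eqVlt; apply/orP; left; apply/eqP; field.
apply: le_ereal_inf_tmp => _ [n /= n0 <-].
have nR0 : 0 < n%:R :> R by rewrite ltr0n.
pose x := ((n.*2%:R)^-1 `^ s / (s + 1) : R).
have x0 : 0 <= x by rewrite divr_ge0 ?powR_ge0 ?(ltW s1).
apply: (@le_trans _ _ ((n%:R `^ s)%:E * (x%:E `^ s^-1 `^ s))%E).
  rewrite -poweRrM mulVf ?gt_eqF // poweRe1; last by rewrite lee_fin.
  rewrite -EFinM lee_fin.
  rewrite /x mulrA -powRM ?invr_ge0 ?(ltW nR0) //.
  by rewrite -mul2n natrM invfM mulrCA mulfV ?mulr1 // gt_eqF.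
apply: lee_wpmul2l; first by rewrite lee_fin powR_ge0.
have le : (x%:E `^ s^-1 <= quantization_error n s (uniform_prob (@ltr01 R)))%E.
  apply: le_ereal_inf_tmp => _ [A /= [A0 An] <-].
  have D0 := uniform_distortion_ge s0 n0 An.
  rewrite -poweR_EFin; apply: (@gt0_ler_poweR _ s^-1); rewrite ?invr_ge0 ?(ltW s0) // ?in_itv /= ?leey ?andbT ?lee_fin //.
  by apply: le_trans D0; rewrite lee_fin.
apply: gt0_ler_poweR; rewrite ?(ltW s0) // ?in_itv /= ?leey ?andbT ?poweR_ge0 //.
  by rewrite lee_fin powR_ge0.
by apply: le_trans le; rewrite poweR_EFin lee_fin powR_ge0.
Qed.

End uniform.

(** * Convexity with a quadratic remainder *)

(** Above [-2] this follows by squaring [1 + x / 2 <= exp (x / 2)]; below, the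
left-hand side is negative. The constant serves both cases. *)
Lemma expR_ge_quadratic (R : realType) (Z x : R) : `|x| <= Z ->
  1 + x + x ^+ 2 / (4 + Z ^+ 2) <= expR x.
Proof.
move=> xZ; have Z2 : 0 < 4 + Z ^+ 2 by rewrite ltr_wpDr ?sqr_ge0.
have [x2|x2] := leP (-2) x.
  have half : (1 + x / 2) ^+ 2 <= expR x.
    have -> : expR x = expR (x / 2) ^+ 2.
      by rewrite -expRM_natl; congr expR; field.
    by rewrite ler_pXn2r ?nnegrE ?expR_ge0 ?expR_ge1Dx //; lra.
  apply: le_trans half.
  have -> : (1 + x / 2) ^+ 2 = 1 + x + x ^+ 2 / 4 by field.
  rewrite lerD2l ler_wpM2l ?sqr_ge0 // lef_pV2 ?posrE //.
  by rewrite lerDl sqr_ge0.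
have xx : x ^+ 2 / (4 + Z ^+ 2) <= 1.
  rewrite ler_pdivrMr // mul1r -[x ^+ 2]real_normK ?num_real //.
  rewrite ler_wpDl // ler_pXn2r ?nnegrE //.
  exact: le_trans xZ.
by have := expR_gt0 x; lra.
Qed.

(** With [y] the length of a half-cell relative to the optimal one, the term
[y `^ r] measures the error, [r / y] the number of points spent, and [r + 1] is
the minimum of their sum, attained at [y = 1] only. *)
Definition excess (R : realType) (r y : R) : R := y `^ r + r / y - (r + 1).

Lemma excess_ge0 (R : realType) (r y : R) : 0 < r -> 0 < y -> 0 <= excess r y.
Proof.
move=> r0 y0; have yE : y = expR (ln y) by rewrite lnK.
rewrite /excess [in y `^ r]yE -expRM [in r / y]yE -expRN.
have h1 := expR_ge1Dx (ln y * r).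
have h2 := ler_wpM2l (ltW r0) (expR_ge1Dx (- ln y)).
by rewrite mulrDr in h2; lra.
Qed.

(** In the variable [ln y], which is bounded here, [excess r] dominates a square
and [y `^ s - 1] is at most linear; a linear term is at most [e] plus a multiple
of its square. *)
Lemma powR_sub1_le_excess (R : realType) (r s lo hi e : R) :
  0 < r -> 0 < s -> 0 < lo -> 0 < e ->
  exists2 C, 0 <= C & forall y, lo <= y <= hi ->
    `|y `^ s - 1| <= e + C * excess r y.
Proof.
move=> r0 s0 lo0 e0; pose Z := `|ln lo| + `|ln hi|.
pose c := r / (4 + Z ^+ 2); pose M := s * expR (s * Z).
have Z0 : 0 <= Z by rewrite addr_ge0.
have Z2 : 0 < 4 + Z ^+ 2 by rewrite ltr_wpDr ?sqr_ge0.
have c0 : 0 < c by rewrite divr_gt0.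
have M0 : 0 < M by rewrite mulr_gt0 ?expR_gt0.
have C0 : 0 <= M ^+ 2 / (4 * e) / c.
  by apply: divr_ge0 (ltW c0); rewrite divr_ge0 ?sqr_ge0 // mulr_ge0 // ltW.
exists (M ^+ 2 / (4 * e) / c) => //.
move=> y /andP[loy yhi]; have y0 : 0 < y by exact: lt_le_trans loy.
pose z := ln y; have yE : y = expR z by rewrite lnK.
have zZ : `|z| <= Z.
  have l1 : ln lo <= z by rewrite ler_ln ?posrE.
  have l2 : z <= ln hi by rewrite ler_ln ?posrE // (lt_le_trans y0).
  have := ler_norm (ln hi); have := ler_norm (- ln lo); rewrite normrN.
  have := normr_ge0 (ln hi); have := normr_ge0 (ln lo).
  by rewrite /Z ler_norml => *; apply/andP; split; lra.
have exc : c * z ^+ 2 <= excess r y.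
  have h1 := expR_ge1Dx (z * r).
  have h2 : 1 + - z + (- z) ^+ 2 / (4 + Z ^+ 2) <= expR (- z).
    by apply: expR_ge_quadratic; rewrite normrN.
  rewrite /excess [in y `^ r]yE -expRM [in r / y]yE -expRN.
  have := ler_wpM2l (ltW r0) h2; rewrite sqrrN mulrDr => h3.
  by rewrite /c mulrAC -mulrA; lra.
have lin : `|y `^ s - 1| <= M * `|z|.
  rewrite yE -expRM; set x := z * s.
  have xZ : `|x| <= s * Z by rewrite normrM (gtr0_norm s0) mulrC ler_wpM2l ?(ltW s0).
  have h1 := expR_ge1Dx x.
  have h2 : expR x - 1 <= x * expR x.
    have := ler_wpM2l (expR_ge0 x) (expR_ge1Dx (- x)).
    by rewrite expRxMexpNx_1; lra.
  have E1 : 1 <= expR (s * Z) by rewrite -expR0 ler_expR mulr_ge0 // ltW.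
  have xM : `|x| <= M * `|z|.
    rewrite normrM (gtr0_norm s0) mulrC /M ler_wpM2r // ler_peMr // ltW //.
  have xe : `|x| * expR x <= M * `|z|.
    rewrite normrM (gtr0_norm s0) /M [X in X * _ <= _]mulrC -!mulrA ler_wpM2l ?(ltW s0) //.
    rewrite mulrC ler_wpM2r // ler_expR (le_trans _ xZ) // ler_norm //.
  rewrite ler_norml; apply/andP; split.
    have := ler_norm (- x); rewrite normrN; lra.
  apply: (le_trans h2); apply: le_trans xe.
  by rewrite ler_wpM2r ?expR_ge0 // ler_norm.
apply: (le_trans lin).
apply: (@le_trans _ _ (e + M ^+ 2 / (4 * e) / c * (c * z ^+ 2))); last first.
  by rewrite lerD2l ler_wpM2l.
rewrite -[z ^+ 2]real_normK ?num_real // mulrA divfK ?gt_eqF //.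
rewrite -subr_ge0 [leRHS](_ : _ = (2 * e - M * `|z|) ^+ 2 / (4 * e)); last first.
  by field; rewrite gt_eqF.
by rewrite divr_ge0 ?sqr_ge0 // mulr_ge0 // ltW.
Qed.

(** * Estimates for one stationary quantizer *)

(** Up to normalisation, the limiting density of the points of asymptotically
optimal quantizers. *)
Definition point_density (R : realType) (r : R) (f : R -> R) x : R :=
  f x `^ (r + 1)^-1.

(** Optimal gaps are inversely proportional to the point density, so their [s]-th
powers turn [f] into this weight. *)
Definition mismatch_density (R : realType) (r s : R) (f : R -> R) x : R :=
  f x `^ (1 - s / (r + 1)).

Section stationary_quantizer.
Context {R : realType}.
Variables (k a b r I : R) (f : R -> R) (P : probability (measurableTypeR R) R).
Hypotheses (k0 : 0 <= k) (ab : a < b) (fab : log_lipschitz k a b f).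
Hypotheses (hP : has_density P a b f) (r0 : 0 < r) (I0 : 0 < I).
Hypothesis wI :
  (\int[lebesgue_measure]_(x in `[a, b]) (point_density r f x)%:E = I%:E)%E.
Variables (n : nat) (A : {fset R}).
Hypotheses (n0 : (0 < n)%N) (A0 : A != fset0) (An : (#|` A| <= n)%N).
Hypothesis Ast : stationary a b f r A.

Local Notation p := (node a b A).
Local Notation N := (#|` A|.*2).
Local Notation h := (gap p).
Local Notation c := (center p).
Local Notation w := (point_density r f).

Let Aab : [set` A] `<=` `[a, b]. Proof. by case: Ast. Qed.
Let hc : half_cells a b #|` A| p. Proof. exact: node_half_cells. Qed.
Let r1 : 0 < r + 1. Proof. by rewrite addr_gt0. Qed.
Let nR0 : 0 < n%:R :> R. Proof. by rewrite ltr0n. Qed.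
Let f0 x : x \in `[a, b] -> 0 < f x. Proof. by case: fab => _ + _; apply. Qed.
Let h0 j : (j < N)%N -> 0 <= h j. Proof. exact: (gap_ge0 hc). Qed.
Let cab j : (j < N)%N -> c j \in `[a, b]. Proof. exact: (center_in hc). Qed.
Let ba0 : 0 < b - a. Proof. by rewrite subr_gt0. Qed.
Let aab : a \in `[a, b]. Proof. by rewrite in_itv/= lexx ltW. Qed.
Let kw := k * `|(r + 1)^-1|.
Let wab : log_lipschitz kw a b w. Proof. exact: log_lipschitz_powR. Qed.
Let w0 x : x \in `[a, b] -> 0 < w x. Proof. by move=> /f0 fx; exact: powR_gt0. Qed.
Let kwk : kw <= k.
Proof.
rewrite /kw ger0_norm ?invr_ge0 ?(ltW r1) // ler_piMr // invf_le1 //.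
by rewrite lerDr ltW.
Qed.

Definition gap_ratio : R := expR (2 * (k / r) * (b - a)).

Let K0 : 0 < gap_ratio. Proof. exact: expR_gt0. Qed.

(** The half-cells are comparable, at most [2 n] in number, and their lengths add
up to [b - a]. *)
Lemma gap_lower j : (j < N)%N -> (b - a) / (2 * gap_ratio) <= n%:R * h j.
Proof.
move=> jN; rewrite ler_pdivrMr ?mulr_gt0 // -(sum_gap hc).
apply: (@le_trans _ _ (\sum_(i < N) gap_ratio * h j)).
  apply: ler_sum => i _.
  exact: (stationary_gaps k0 fab r0 A0 Ast (ltn_ord i) jN).
rewrite sumr_const card_ord -[leLHS]mulr_natl [leRHS](_ : _ = (2 * n%:R) * (gap_ratio * h j)); last by ring.
rewrite ler_wpM2r ?mulr_ge0 ?h0 ?(ltW K0) //.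
by rewrite -natrM ler_nat mul2n leq_double.
Qed.

Definition gap_upper_bound (M : R) : R :=
  gap_ratio * (M * (r + 1) * expR (2 * k * (b - a)) / (f a * (b - a))) `^ r^-1.

(** The half-cells are comparable, so a single one much longer than [1 / n] would
make the whole distortion too large. *)
Lemma gap_upper M j : (distortion P r A <= (M / n%:R `^ r)%:E)%E -> (j < N)%N ->
  n%:R * h j <= gap_upper_bound M.
Proof.
move=> DM jN.
have hba i : (i < N)%N -> h i <= b - a.
  move=> iN; apply: lerB; [exact: (half_cells_le_b hc)|].
  by apply: (half_cells_ge_a hc); exact: ltnW.
have := half_cells_energy_ge hc k0 fab hba r0 (measurable_min_dist r A).
have H0 (i : 'I_N) x : x \in `[p i, p i.+1] ->
    ((`|x - c i| `^ r)%:E <= min_dist r A x)%E.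
  by move=> xi; rewrite (min_dist_node r0 Aab (ltn_ord i) xi).
move=> /(_ H0); rewrite -(distortion_density fab hP) => /le_trans/(_ DM).
rewrite lee_fin => E.
pose Q := f a * expR (- (k * (b - a))) * (h j / gap_ratio) `^ r.
have Qle : Q * (b - a) <= \sum_(i < N) f (c i) * h i `^ (r + 1).
  rewrite -(sum_gap hc) mulr_sumr; apply: ler_sum => i _.
  have hi0 := h0 (ltn_ord i).
  have -> : h i `^ (r + 1) = h i `^ r * h i.
    by rewrite powRD ?powRr1 // (gt_eqF r1).
  rewrite mulrA ler_wpM2r //; apply: ler_pM.
  - by rewrite mulr_ge0 ?expR_ge0 // ltW // f0.
  - exact: powR_ge0.
  - rewrite expRN ler_pdivrMr ?expR_gt0 //.
    exact: (log_lipschitz_le k0 fab aab (cab (ltn_ord i))).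
  - apply: ge0_ler_powR; rewrite ?nnegrE ?divr_ge0 ?h0 ?(ltW r0) ?(ltW K0) //.
    rewrite ler_pdivrMr // mulrC.
    exact: (stationary_gaps k0 fab r0 A0 Ast jN (ltn_ord i)).
have fa0 := f0 aab.
have nh : (n%:R * h j / gap_ratio) `^ r <=
    M * (r + 1) * expR (2 * k * (b - a)) / (f a * (b - a)).
  rewrite -mulrA powRM ?(ltW nR0) ?divr_ge0 ?h0 ?(ltW K0) //.
  have {}E : expR (- (k * (b - a))) * (Q * (b - a) / (r + 1)) <= M / n%:R `^ r.
    by apply: le_trans E; rewrite ler_wpM2l ?expR_ge0 // ler_wpM2r ?invr_ge0 ?(ltW r1).
  have -> : expR (2 * k * (b - a)) = expR (k * (b - a)) * expR (k * (b - a)).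
    by rewrite -expRD; congr expR; ring.
  rewrite ler_pdivlMr ?mulr_gt0 //; move: E; rewrite /Q expRN.
  have := expR_gt0 (k * (b - a)); have : 0 < n%:R `^ r :> R by exact: powR_gt0.
  move: (expR _) (_ `^ r) (_ `^ r) => e Hr nr nr0 e0.
  have pos : 0 <= nr * (e * e) * (r + 1).
    by apply/ltW/mulr_gt0 => //; apply/mulr_gt0/mulr_gt0.
  move=> /(ler_wpM2r pos).
  rewrite [X in X <= _](_ : _ = nr * Hr * (f a * (b - a))); last first.
    by field; rewrite !gt_eqF.
  rewrite [X in _ <= X](_ : _ = M * (r + 1) * (e * e)) //.
  by field; rewrite gt_eqF.
rewrite /gap_upper_bound [leRHS]mulrC -ler_pdivrMr //.
have x0 : 0 <= n%:R * h j / gap_ratio.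
  by rewrite divr_ge0 ?mulr_ge0 ?h0 ?(ltW K0) ?(ltW nR0).
rewrite [leLHS](_ : _ = (n%:R * h j / gap_ratio) `^ r `^ r^-1); last first.
  by rewrite -powRrM mulfV ?gt_eqF // powRr1.
by apply: ge0_ler_powR; rewrite ?nnegrE ?powR_ge0 ?invr_ge0 ?(ltW r0) ?(le_trans (powR_ge0 _ _) nh).
Qed.

(** The length of a half-cell relative to the optimal one, [I / (2 n w)]. *)
Definition relative_gap j : R := 2 * n%:R / I * (h j * w (c j)).

Let y := relative_gap.

Let h_gt0 j : (j < N)%N -> 0 < h j.
Proof.
move=> jN; have := gap_lower jN; rewrite -(pmulr_rgt0 _ nR0); apply: lt_le_trans.
by rewrite divr_gt0 ?mulr_gt0.
Qed.

Let y_gt0 j : (j < N)%N -> 0 < y j.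
Proof.
move=> jN; rewrite /y /relative_gap !mulr_gt0 ?invr_gt0 ?h_gt0 //.
by apply: w0; exact: cab.
Qed.

(** The three terms of [excess] sum to the distortion, to the number of half-cells
and to the integral [I]. When the distortion is nearly optimal they nearly cancel,
although each summand is nonnegative. *)
Lemma excess_sum G d : (forall j, (j < N)%N -> n%:R * h j <= G) ->
  (distortion P r A <= d%:E)%E ->
  \sum_(j < N) h j * w (c j) * excess r (y j) <=
    (2 * n%:R / I) `^ r * (r + 1) * expR (k * G / n%:R) * d
      + r * I - (r + 1) * (expR (- (k * G / n%:R)) * I).
Proof.
move=> hG Dd.
have hGn j : (j < N)%N -> h j <= G / n%:R.
  by move=> jN; rewrite ler_pdivlMr // mulrC hG.
have G0 : (0 < N)%N -> 0 <= G / n%:R by move=> /[dup] /h0 /le_trans + /hGn; apply.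
have N0 : (0 < N)%N by rewrite double_gt0 cardfs_gt0.
have nI0 : 0 < 2 * n%:R / I by rewrite divr_gt0 ?mulr_gt0.
have termE (j : 'I_N) : h j * w (c j) * excess r (y j) =
    (2 * n%:R / I) `^ r * (f (c j) * h j `^ (r + 1)) + r * (I / (2 * n%:R))
      - (r + 1) * (w (c j) * h j).
  have fc0 := f0 (cab (ltn_ord j)); have wc0 := w0 (cab (ltn_ord j)).
  have hj0 := h_gt0 (ltn_ord j); have yj0 := y_gt0 (ltn_ord j).
  have E1 : h j * w (c j) * y j `^ r =
      (2 * n%:R / I) `^ r * (f (c j) * h j `^ (r + 1)).
    have -> : f (c j) = w (c j) `^ (r + 1).
      by rewrite /point_density -powRrM mulVf ?gt_eqF // powRr1 // ltW.
    rewrite /y /relative_gap powRM ?(ltW nI0) ?mulr_ge0 ?(ltW hj0) ?(ltW wc0) //.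
    have -> : w (c j) `^ (r + 1) * h j `^ (r + 1) = h j * w (c j) * (h j * w (c j)) `^ r.
      rewrite -powRM ?(ltW hj0) ?(ltW wc0) // [w _ * h j]mulrC powRD ?(gt_eqF r1) //.
      by rewrite powRr1 ?mulr_ge0 ?(ltW hj0) ?(ltW wc0) // [LHS]mulrC.
    by rewrite mulrCA.
  have E2 : h j * w (c j) * (r / y j) = r * (I / (2 * n%:R)).
    rewrite /y /relative_gap; field.
    by rewrite !gt_eqF //=.
  by rewrite /excess mulrBr mulrDr E1 E2; ring.
rewrite (eq_bigr _ (fun j _ => termE j)) sumrB big_split /=.
rewrite -[X in X + _ - _]mulr_sumr -[X in _ - X]mulr_sumr.
apply: lerB; last first.
  rewrite ler_wpM2l ?(ltW r1) //.
  have := half_cells_riemann_sum hc (mulr_ge0 k0 (normr_ge0 _)) wab hGn.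
  rewrite wI => /andP[_ +]; rewrite lee_fin => lo.
  rewrite expRN mulrC ler_pdivrMr ?expR_gt0 // mulrC (le_trans lo) //.
  rewrite ler_wpM2r ?sumr_ge0 //.
    by move=> j _; rewrite mulr_ge0 ?h0 ?(ltW (w0 _)) ?cab.
  by rewrite ler_expR -mulrA ler_wpM2r ?G0 ?kwk.
apply: lerD; last first.
  rewrite sumr_const card_ord -[_ *+ N]mulr_natl.
  have -> : N%:R * (r * (I / (2 * n%:R))) = r * (I * (N%:R / (2 * n%:R))) by ring.
  rewrite ler_wpM2l ?(ltW r0) // ler_piMr ?(ltW I0) // ler_pdivrMr ?mulr_gt0 //.
  by rewrite mul1r -natrM ler_nat mul2n leq_double.
rewrite -!mulrA ler_wpM2l ?powR_ge0 //.
have := half_cells_energy_ge hc k0 fab hGn r0 (measurable_min_dist r A).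
have HD (i : 'I_N) x : x \in `[p i, p i.+1] ->
    ((`|x - c i| `^ r)%:E <= min_dist r A x)%E.
  by move=> xi; rewrite (min_dist_node r0 Aab (ltn_ord i) xi).
move=> /(_ HD); rewrite -(distortion_density fab hP) => /le_trans/(_ Dd).
rewrite lee_fin expRN mulrC ler_pdivrMr ?expR_gt0 // ler_pdivrMr // mulrA => E.
by apply: (le_trans E); rewrite le_eqVlt; apply/orP; left; apply/eqP; ring.
Qed.

Section other_exponent.
Variables (s V : R).
Hypothesis s0 : 0 < s.
Local Notation v := (mismatch_density r s f).
Let kv := k * `|1 - s / (r + 1)|.
Let s1 : 0 < s + 1. Proof. by rewrite addr_gt0. Qed.
Let v0 x : 0 <= v x. Proof. exact: powR_ge0. Qed.
Hypothesis vV :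
  (\int[lebesgue_measure]_(x in `[a, b]) (v x)%:E = V%:E)%E.

Let T := \sum_(j < N) v (c j) * h j * y j `^ s.
Let S := \sum_(j < N) v (c j) * h j.

Lemma distortion_other_exponent G : (forall j, (j < N)%N -> n%:R * h j <= G) ->
  ((expR (- (k * G / n%:R)) * ((I / 2) `^ s * T / (s + 1)))%:E
    <= (n%:R `^ s)%:E * distortion P s A
    <= (expR (k * G / n%:R) * ((I / 2) `^ s * T / (s + 1)))%:E)%E.
Proof.
move=> hG.
have hGn j : (j < N)%N -> h j <= G / n%:R.
  by move=> jN; rewrite ler_pdivlMr // mulrC hG.
have ns0 : 0 < n%:R `^ s :> R by exact: powR_gt0.
have TE : (I / 2) `^ s * T = n%:R `^ s * \sum_(j < N) f (c j) * h j `^ (s + 1).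
  rewrite /T !mulr_sumr; apply: eq_bigr => j _.
  have fc0 := f0 (cab (ltn_ord j)); have wc0 := w0 (cab (ltn_ord j)).
  have hj0 := h_gt0 (ltn_ord j).
  have fE : f (c j) = v (c j) * w (c j) `^ s.
    rewrite /point_density /mismatch_density -powRrM -powRD ?fc0 ?(gt_eqF fc0) ?implybT //.
    by rewrite [_^-1 * s]mulrC subrK powRr1 // ltW.
  rewrite [h j `^ (s + 1)]powRD ?(gt_eqF s1) // powRr1 ?(ltW hj0) //.
  rewrite fE.
  have yE : (I / 2) `^ s * y j `^ s = n%:R `^ s * (h j `^ s * w (c j) `^ s).
    rewrite -powRM ?divr_ge0 ?(ltW I0) ?(ltW (y_gt0 _)) //.
    rewrite -!powRM ?mulr_ge0 ?(ltW nR0) ?(ltW hj0) ?(ltW wc0) //.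
    by congr (_ `^ _); rewrite /y /relative_gap; field; rewrite gt_eqF.
  rewrite [LHS](_ : _ = v (c j) * h j * ((I / 2) `^ s * y j `^ s)); last by ring.
  by rewrite yE; ring.
have HD (i : 'I_N) x : x \in `[p i, p i.+1] ->
    min_dist s A x = (`|x - c i| `^ s)%:E.
  by move=> xi; rewrite (min_dist_node s0 Aab (ltn_ord i) xi).
have reassoc e X : e * (n%:R `^ s * X / (s + 1)) = n%:R `^ s * (e * (X / (s + 1))) :> R.
  by ring.
rewrite TE !reassoc -!mulrA !(EFinM (n%:R `^ s)) (distortion_density fab hP).
apply/andP; split; (apply: lee_wpmul2l; first by rewrite lee_fin ltW).
  apply: (half_cells_energy_ge hc k0 fab hGn s0 (measurable_min_dist s A)).
  by move=> j x xj; rewrite (HD _ _ xj).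
apply: (half_cells_energy_le hc k0 fab hGn s0 (measurable_min_dist s A) (min_dist_ge0 s A)).
by move=> j x xj; rewrite (HD _ _ xj).
Qed.

Lemma weighted_sum_close e C W X :
  0 <= C -> (forall j, (j < N)%N -> `|y j `^ s - 1| <= e + C * excess r (y j)) ->
  (forall x, x \in `[a, b] -> v x <= W * w x) ->
  \sum_(j < N) h j * w (c j) * excess r (y j) <= X ->
  `|T - S| <= e * S + C * W * X.
Proof.
move=> C0 yP vW excX.
have W0 : 0 <= W.
  by rewrite -(pmulr_lge0 _ (w0 aab)) (le_trans _ (vW _ aab)) ?v0.
rewrite /T /S -sumrB (le_trans (ler_norm_sum _ _ _)) //.
apply: (@le_trans _ _ (\sum_(j < N) (e * (v (c j) * h j) +
   C * W * (h j * w (c j) * excess r (y j))))); last first.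
  by rewrite big_split /= -!mulr_sumr lerD2l ler_wpM2l ?mulr_ge0.
apply: ler_sum => j _.
have hj := h0 (ltn_ord j).
rewrite -[X in _ - X]mulr1 -mulrBr normrM ger0_norm ?mulr_ge0 //.
apply: (le_trans (ler_wpM2l _ (yP _ (ltn_ord j)))); first by rewrite mulr_ge0.
rewrite mulrDr [v _ * _ * e]mulrC lerD2l.
have := vW _ (cab (ltn_ord j)) => vWj.
have E0 := excess_ge0 r0 (y_gt0 (ltn_ord j)).
rewrite mulrCA -mulrA ler_wpM2l //.
rewrite [leRHS](_ : _ = W * w (c j) * h j * excess r (y j)); last by ring.
by rewrite ler_wpM2r // ler_wpM2r.
Qed.

Lemma weight_sum_bounds G : (forall j, (j < N)%N -> n%:R * h j <= G) ->
  expR (- (kv * G / n%:R)) * V <= S <= expR (kv * G / n%:R) * V.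
Proof.
move=> hG.
have hGn j : (j < N)%N -> h j <= G / n%:R.
  by move=> jN; rewrite ler_pdivlMr // mulrC hG.
have vab : log_lipschitz kv a b v by exact: log_lipschitz_powR.
have := half_cells_riemann_sum hc (mulr_ge0 k0 (normr_ge0 _)) vab hGn.
rewrite vV !lee_fin -/S -!(mulrA kv) => /andP[lo hi]; apply/andP; split.
  by rewrite expRN mulrC ler_pdivrMr ?expR_gt0 // mulrC.
by move: lo; rewrite expRN mulrC ler_pdivrMr ?expR_gt0 // mulrC.
Qed.

(** With bounded relative gaps, a small total excess forces the relative gaps to be
close to one on average, hence also their [s]-th powers. *)
Lemma mismatch_bounds G X e C W :
  (forall j, (j < N)%N -> n%:R * h j <= G) -> 0 <= e <= 1 -> 0 <= C ->
  (forall j, (j < N)%N -> `|y j `^ s - 1| <= e + C * excess r (y j)) ->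
  (forall x, x \in `[a, b] -> v x <= W * w x) ->
  \sum_(j < N) h j * w (c j) * excess r (y j) <= X ->
  ((expR (- (k * G / n%:R)) * ((I / 2) `^ s *
      ((1 - e) * (expR (- (kv * G / n%:R)) * V) - C * W * X) / (s + 1)))%:E
    <= (n%:R `^ s)%:E * distortion P s A
    <= (expR (k * G / n%:R) * ((I / 2) `^ s *
      ((1 + e) * (expR (kv * G / n%:R) * V) + C * W * X) / (s + 1)))%:E)%E.
Proof.
move=> hG /andP[e0 e1] C0 yP vW excX.
have /andP[lo hi] := distortion_other_exponent hG.
have /andP[Slo Shi] := weight_sum_bounds hG.
have := weighted_sum_close C0 yP vW excX; rewrite ler_norml => /andP[Tlo Thi].
have mono t1 t2 z : t1 <= t2 ->
    expR z * ((I / 2) `^ s * t1 / (s + 1)) <= expR z * ((I / 2) `^ s * t2 / (s + 1)).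
  move=> t12; rewrite ler_wpM2l ?expR_ge0 // ler_wpM2r ?invr_ge0 ?(ltW s1) //.
  by rewrite ler_wpM2l ?powR_ge0.
apply/andP; split.
  apply: le_trans lo; rewrite lee_fin; apply: mono.
  have e1' : 0 <= 1 - e by rewrite subr_ge0.
  by have := ler_wpM2l e1' Slo; rewrite -/T -/S in Tlo *; lra.
apply: (le_trans hi); rewrite lee_fin; apply: mono.
have e1' : 0 <= 1 + e by rewrite addr_ge0.
by have := ler_wpM2l e1' Shi; rewrite -/T -/S in Thi *; lra.
Qed.

End other_exponent.

End stationary_quantizer.

(** * Passage to the limit *)

Lemma cvg_expR_div (R : realType) (x : R) : expR (x / n%:R) @[n --> \oo] --> (1 : R).
Proof.
have inv0 : (n%:R^-1 : R) @[n --> \oo] --> (0 : R).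
  rewrite -(cvg_shiftn 1) /=; apply: cvg_trans (@cvg_harmonic R).
  by apply: near_eq_cvg; apply: nearW => n /=; rewrite addn1.
rewrite -[X in _ --> X](@expR0 R).
have x0 : x / n%:R @[n --> \oo] --> (0 : R).
  by rewrite -(mulr0 x); exact: cvgMl_tmp.
exact: (cvg_comp _ _ x0 (@continuous_expR R 0)).
Qed.

(** The tolerance [e] is removed only after [n] has gone to infinity, the bounds
not being uniform in it. *)
Lemma cvge_squeeze_family (R : realType) (X : nat -> \bar R) (L : R)
    (lo up : R -> nat -> R) : 0 <= L ->
  (forall e, 0 < e <= 1 -> \forall n \near \oo, ((lo e n)%:E <= X n <= (up e n)%:E)%E) ->
  (forall e, lo e n @[n --> \oo] --> (1 - e) * L) ->
  (forall e, up e n @[n --> \oo] --> (1 + e) * L) ->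
  X n @[n --> \oo] --> L%:E.
Proof.
move=> L0 Xb loL upL.
have finX : \forall n \near \oo, X n \is a fin_num.
  apply: filterS (Xb 1 _); last by rewrite ltr01 lexx.
  by move=> n; case: (X n) => [x| |] //; rewrite ?leye_eq ?leeNy_eq => /andP[].
apply: cvg_EFin => //; apply/cvgrPdist_lt => d d0 /=.
pose e := Num.min 1 (d / (L + 1) / 2).
have L1 : 0 < L + 1 by rewrite ltr_wpDl.
have e0 : 0 < e by rewrite lt_min ltr01 !divr_gt0.
have e1 : e <= 1 by rewrite ge_min lexx.
have eL : e * L < d.
  have : e * (L + 1) <= d / 2.
    by rewrite -ler_pdivlMr // mulrAC ge_min lexx orbT.
  by rewrite mulrDr mulr1; lra.
have e01 : 0 < e <= 1 by rewrite e0.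
have l1 : L - d < (1 - e) * L by lra.
have u1 : (1 + e) * L < L + d by lra.
near=> n.
have Xn : X n \is a fin_num by near: n.
have lon : L - d < lo e n by near: n; exact: (cvgr_gt _ (loL e)).
have upn : up e n < L + d by near: n; exact: (cvgr_lt _ (upL e)).
have : ((lo e n)%:E <= X n <= (up e n)%:E)%E by near: n; exact: Xb.
rewrite -(fineK Xn) !lee_fin => /andP[h1 h2].
by rewrite distrC ltr_norml; apply/andP; split; lra.
Unshelve. all: by end_near.
Qed.

(** The inverse of 0 being [+oo], a positive real ratio excludes a null divisor. *)
Lemma le_fine_ratio (R : realType) (D Q : \bar R) (U : R) :
  (0 <= D)%E -> (0 <= Q)%E -> (Q <= U%:E)%E -> (D / Q)%E \is a fin_num ->
  0 < fine (D / Q)%E -> (D <= (fine (D / Q)%E * U)%:E)%E.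
Proof.
move=> D0; case: Q => [q| |] //; rewrite !lee_fin => q0 qU.
have [q00|qn0] := eqVneq q 0.
  rewrite q00 inve0; move: D0; rewrite le_eqVlt => /predU1P[<-|D0].
    by rewrite mul0e /= ltxx.
  by rewrite gt0_muley.
have qp : 0 < q by rewrite lt_neqAle eq_sym qn0.
rewrite inver (negPf qn0); case: D D0 => [d| |] // D0 /=.
  move=> _ dq; rewrite lee_fin -[leLHS](divfK qn0) ler_wpM2l //.
  exact: ltW.
by rewrite gt0_mulye // lte_fin invr_gt0.
Qed.

Lemma QconstE (R : realType) (r s a b I V : R) (f : R -> R) :
  0 < s -> 0 < I -> 
  (\int[lebesgue_measure]_(x in `[a, b]) (point_density r f x)%:E = I%:E)%E ->
  (\int[lebesgue_measure]_(x in `[a, b]) (mismatch_density r s f x)%:E = V%:E)%E ->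
  Qconst r s a b f = ((I / 2) `^ s * V / (s + 1))%:E.
Proof.
move=> s0 I0 wI vV; rewrite /Qconst JconstE // [X in (_ * X `^ s * _)%E]wI.
rewrite [X in (_ * X)%E]vV poweR_EFin -!EFinM; congr EFin.
by rewrite powRM ?invr_ge0 ?(ltW I0) //; ring.
Qed.

Unset Implicit Arguments.

Theorem proposition2 (R : realType) (a b : R) (hab : a < b)
    (f : R -> R) (P : probability (measurableTypeR R) R)
    (hP : has_density P a b f)
    (f_ge0 : forall x, x \in `[a, b] -> 0 <= f x)
    (f_lip : [lipschitz f x | x in `[a, b]])
    (f_away0 : exists2 m : R, 0 < m & forall x, x \in `[a, b] -> m <= f x)
    (r : R) (hr : 0 < r) (alpha : nat -> {fset R})
    (alpha_stat : forall n, (0 < n)%N -> stationary a b f r (alpha n))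
    (alpha_opt : asymptotically_optimal P r a b alpha) :
  forall s : R, 0 < s ->
    ((n%:R `^ s)%:E * \int[P]_(x in `[a, b]) min_dist s (alpha n) x)%E
      @[n --> \oo] --> Qconst r s a b f.
Proof.
move=> s s0.
have [m m0 mf] := f_away0.
have [k k0 fab] := lipschitz_log_lipschitz f_lip m0 mf.
have wab : log_lipschitz _ a b (point_density r f) := log_lipschitz_powR (r + 1)^-1 fab.
have vab : log_lipschitz _ a b (mismatch_density r s f) :=
  log_lipschitz_powR (1 - s / (r + 1)) fab.
set kw := k * `|(r + 1)^-1| in wab; set kv := k * `|1 - s / (r + 1)| in vab.
have kw0 : 0 <= kw by rewrite mulr_ge0.
have kv0 : 0 <= kv by rewrite mulr_ge0.
have [I I0 wI] := log_lipschitz_integral_gt0 kw0 hab wab.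
have [V V0 vV] := log_lipschitz_integral_gt0 kv0 hab vab.
rewrite (QconstE s0 I0 wI vV).
have r1 : 0 < r + 1 by rewrite addr_gt0.
have s1 : 0 < s + 1 by rewrite addr_gt0.
have [C C0 CU] := quantization_error_upper k0 hab fab hP hr I0 wI.
have [quant ratio] := alpha_opt.
pose U n : R := expR (C / n%:R) * (I * (I / n.*2%:R) `^ r / (r + 1)).
pose D n := distortion P r (alpha n).
pose E n := (quantization_error n r P `^ r)%E.
pose rho n : R := fine (D n / E n)%E.
have rho1 : rho n @[n --> \oo] --> (1 : R) by exact: (fine_cvg ratio).
have aab : a \in `[a, b] by rewrite in_itv/= lexx ltW.
have wa0 : 0 < point_density r f a by case: wab => _ + _; apply.
have va0 : 0 < mismatch_density r s f a by case: vab => _ + _; apply.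
have Vx x : x \in `[a, b] -> mismatch_density r s f x <=
    mismatch_density r s f a * expR (kv * (b - a)).
  by move=> xab; exact: (log_lipschitz_le kv0 vab xab aab).
have wlox x : x \in `[a, b] ->
    point_density r f a * expR (- (kw * (b - a))) <= point_density r f x.
  move=> xab; rewrite expRN ler_pdivrMr ?expR_gt0 //.
  exact: (log_lipschitz_le kw0 wab aab xab).
have whix x : x \in `[a, b] ->
    point_density r f x <= point_density r f a * expR (kw * (b - a)).
  by move=> xab; exact: (log_lipschitz_le kw0 wab xab aab).
pose wlo := point_density r f a * expR (- (kw * (b - a))).
pose whi := point_density r f a * expR (kw * (b - a)).
have wlo0 : 0 < wlo by rewrite mulr_gt0 ?expR_gt0.
pose W := mismatch_density r s f a * expR (kv * (b - a)) / wlo.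
have vW x : x \in `[a, b] -> mismatch_density r s f x <= W * point_density r f x.
  move=> xab; apply: (le_trans (Vx x xab)).
  rewrite /W [leRHS]mulrAC ler_pdivlMr // ler_wpM2l ?wlox //.
  by rewrite mulr_ge0 ?expR_ge0 // ltW.
(* The factor 2 absorbs [rho n], which tends to one. *)
pose M := 2 * (expR C * (I * (I / 2) `^ r / (r + 1))).
pose G := gap_upper_bound k a b r f M.
pose lo := 2 / I * ((b - a) / (2 * gap_ratio k a b r) * wlo).
pose hi := 2 / I * (G * whi).
have K0 : 0 < gap_ratio k a b r by exact: expR_gt0.
have lo0 : 0 < lo.
  by rewrite mulr_gt0 ?divr_gt0 // mulr_gt0 // divr_gt0 ?subr_gt0 ?mulr_gt0.
(* The bound of [excess_sum] for the distortion [rho n * U n]. *)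
pose X n : R := I * (expR (k * G / n%:R) * rho n * expR (C / n%:R)) + r * I
   - (r + 1) * (expR (- (k * G / n%:R)) * I).
have expNn x : expR (- (x / n%:R)) @[n --> \oo] --> (1 : R).
  by under eq_cvg do rewrite -mulNr; exact: cvg_expR_div.
have X0 : X n @[n --> \oo] --> (0 : R).
  have -> : (0 : R) = I * (1 * 1 * 1) + r * I - (r + 1) * (1 * I) by ring.
  apply: cvgB; last first.
    by apply: cvgM; [exact: cvg_cst|apply: cvgM; [exact: expNn|exact: cvg_cst]].
  apply: cvgD; last exact: cvg_cst.
  apply: cvgM; first exact: cvg_cst.
  apply: cvgM; last exact: cvg_expR_div.
  by apply: cvgM; [exact: cvg_expR_div|exact: rho1].
have UE n : (0 < n)%N ->
    U n = expR (C / n%:R) * (I * (I / 2) `^ r / (r + 1)) / n%:R `^ r.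
  move=> n0; have nR0 : 0 < n%:R :> R by rewrite ltr0n.
  have -> : (I / 2) `^ r = n%:R `^ r * (I / n.*2%:R) `^ r.
    rewrite -powRM ?(ltW nR0) ?divr_ge0 ?(ltW I0) //; congr (_ `^ _).
    by rewrite -mul2n natrM; field; rewrite gt_eqF.
  rewrite /U; field.
  by rewrite !gt_eqF //= powR_gt0.
have good : \forall n \near \oo, [/\ (0 < n)%N,
    (D n <= (rho n * U n)%:E)%E & rho n < 2].
  near=> n.
  have n0 : (0 < n)%N by near: n; exact: nbhs_infty_gt.
  have rho2 : rho n < 2.
    by near: n; apply: (cvgr_lt _ rho1); rewrite ltr1n.
  have rho0 : 0 < rho n by near: n; apply: (cvgr_gt _ rho1); rewrite ltr01.
  split => //; apply: le_fine_ratio => //.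
  - by apply: integral_ge0 => x _; exact: min_dist_ge0.
  - exact: poweR_ge0.
  - exact: CU.
  - move: rho0; rewrite /rho; case: (_ / _)%E => //= ; rewrite ltxx //.
have L0 : 0 <= (I / 2) `^ s * V / (s + 1).
  by rewrite divr_ge0 ?mulr_ge0 ?powR_ge0 ?(ltW V0) ?(ltW s1).
have Ce_ex e : exists Ce, 0 < e -> 0 <= Ce /\
    forall y, lo <= y <= hi -> `|y `^ s - 1| <= e + Ce * excess r y.
  have [e0|e0] := ltP 0 e; last by exists 0.
  by have [Ce ? ?] := powR_sub1_le_excess hi hr s0 lo0 e0; exists Ce.
have [Ce CeP] := choice Ce_ex.
apply: (@cvge_squeeze_family _ _ _
  (fun e n => expR (- (k * G / n%:R)) * ((I / 2) `^ s *
      ((1 - e) * (expR (- (kv * G / n%:R)) * V) - Ce e * W * X n) / (s + 1)))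
  (fun e n => expR (k * G / n%:R) * ((I / 2) `^ s *
      ((1 + e) * (expR (kv * G / n%:R) * V) + Ce e * W * X n) / (s + 1)))) => //.
- move=> e /andP[e0 e1]; have [Ce0 CeB] := CeP e e0.
  apply: filterS good => n [n0 Dn rho2].
  have [A0 Aab An] := quant n n0.
  have Ast := alpha_stat n n0.
  have nR0 : 0 < n%:R :> R by rewrite ltr0n.
  have DM : (distortion P r (alpha n) <= (M / n%:R `^ r)%:E)%E.
    apply: (le_trans Dn); rewrite lee_fin UE // mulrA ler_wpM2r ?invr_ge0 ?powR_ge0 //.
    have B0 : 0 <= I * (I / 2) `^ r / (r + 1).
      by rewrite divr_ge0 ?mulr_ge0 ?powR_ge0 ?(ltW I0) ?(ltW r1).
    have eC : expR (C / n%:R) <= expR C.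
      by rewrite ler_expR ler_pdivrMr // ler_peMr // ler1n.
    have := ler_wpM2r B0 eC.
    have : 0 <= expR (C / n%:R) * (I * (I / 2) `^ r / (r + 1)).
      by rewrite mulr_ge0 ?expR_ge0.
    move=> h1 h2; apply: (le_trans (ler_wpM2r h1 (ltW rho2))).
    by rewrite /M ler_wpM2l.
  have hG j : (j < #|` alpha n|.*2)%N -> n%:R * gap (node a b (alpha n)) j <= G.
    exact: (gap_upper k0 hab fab hP hr n0 A0 Ast DM).
  rewrite (integral_min_dist_density fab hP) -(distortion_density fab hP).
  apply: (mismatch_bounds k0 hab fab hP hr I0 n0 A0 An Ast s0 vV hG) => //.
  + by rewrite (ltW e0).
  + move=> j jN; apply: CeB; rewrite /relative_gap /lo /hi.
    have hc := node_half_cells A0 Aab.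
    have cab := center_in hc jN.
    have glo := gap_lower k0 fab hr A0 An Ast jN.
    rewrite [2 * _ / I * _](_ : _ = 2 / I * (n%:R * gap (node a b (alpha n)) j *
      point_density r f (center (node a b (alpha n)) j))); last by ring.
    have I2 : 0 <= 2 / I by rewrite divr_ge0 // ltW.
    have g0 : 0 <= (b - a) / (2 * gap_ratio k a b r).
      by rewrite divr_ge0 ?subr_ge0 ?mulr_ge0 ?(ltW hab) ?(ltW K0).
    apply/andP; split; rewrite ler_wpM2l //; apply: ler_pM => //.
    * exact: ltW.
    * exact: wlox.
    * exact: le_trans glo.
    * exact: le_trans (ltW wlo0) (wlox _ cab).
    * exact: hG.
    * exact: whix.
  + have := excess_sum k0 hab fab hP hr I0 wI n0 A0 An Ast hG Dn.
    move=> /le_trans; apply; rewrite /X le_eqVlt; apply/orP; left; apply/eqP.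
    congr (_ + _ - _).
    have pw : (2 * n%:R / I) `^ r * (I / n.*2%:R) `^ r = 1.
      rewrite -powRM ?divr_ge0 ?mulr_ge0 ?(ltW I0) ?(ltW nR0) //.
      rewrite (_ : _ * _ = 1) ?powR1 // -mul2n natrM; field.
      by rewrite !gt_eqF.
    rewrite /U [LHS](_ : _ = ((2 * n%:R / I) `^ r * (I / n.*2%:R) `^ r) *
      (I * (expR (k * G / n%:R) * rho n * expR (C / n%:R)))).
      by rewrite pw mul1r.
    by field; rewrite gt_eqF.
- move=> e.
  have -> : (1 - e) * ((I / 2) `^ s * V / (s + 1)) =
      1 * ((I / 2) `^ s * ((1 - e) * (1 * V) - Ce e * W * 0) / (s + 1)).
    by field; rewrite gt_eqF.
  apply: cvgM; first exact: expNn.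
  apply: cvgM; last exact: cvg_cst.
  apply: cvgM; first exact: cvg_cst.
  apply: cvgB; apply: cvgM; [exact: cvg_cst| |exact: cvg_cst|exact: X0].
  by apply: cvgM; [exact: expNn|exact: cvg_cst].
- move=> e.
  have -> : (1 + e) * ((I / 2) `^ s * V / (s + 1)) =
      1 * ((I / 2) `^ s * ((1 + e) * (1 * V) + Ce e * W * 0) / (s + 1)).
    by field; rewrite gt_eqF.
  apply: cvgM; first exact: cvg_expR_div.
  apply: cvgM; last exact: cvg_cst.
  apply: cvgM; first exact: cvg_cst.
  apply: cvgD; apply: cvgM; [exact: cvg_cst| |exact: cvg_cst|exact: X0].
  by apply: cvgM; [exact: cvg_expR_div|exact: cvg_cst].
Unshelve. all: by end_near.
Qed.
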